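(* Let $k$ be an algebraically closed field of characteristic $0$. A Hopf algebra of dimension $16$ over $k$ cannot have coradical isomorphic (as a coalgebra) to any of the following: (i) $k\cdot 1 \oplus \mathcal{M}^c(2,k)$; (ii) $k\cdot 1 \oplus \mathcal{M}^c(2,k)\oplus \mathcal{M}^c(2,k)\oplus \mathcal{M}^c(2,k)$; (iii) $k\cdot 1 \oplus \mathcal{M}^c(3,k)$; (iv) $k\cdot 1 \oplus \mathcal{M}^c(2,k)\oplus \mathcal{M}^c(3,k)$.
   Context: $\mathcal{M}^c(n,k)$ is the $n\times n$ matrix coalgebra: it has a basis $\{e_{ij}\mid 1\le i,j\le n\}$ with $\Delta(e_{ij})=\sum_{r=1}^n e_{ir}\otimes e_{rj}$ and $\epsilon(e_{ij})=\delta_{ij}$. The summand $k\cdot 1$ is the one-dimensional subcoalgebra spanned by the unit element. *)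

(* Defs.v *)
From HB Require Import structures.
From mathcomp Require Import all_boot all_order all_algebra all_field.
From mathcomp Require Import boolp classical_sets.

Set Implicit Arguments.
Unset Strict Implicit.
Unset Printing Implicit Defensive.

Import GRing.Theory VectorInternalTheory.

Local Open Scope ring_scope.

Reserved Notation "u \ox v" (at level 40, left associativity).

(* The tensor product of two finite-dimensional spaces, modelled by matrices: *)
(* the (i, j) coefficient of a tensor is its coordinate on e_i (x) f_j, where  *)
(* e and f are the bases given by the vectType structures.  The universal      *)
(* property is [tens_liftE] (existence) and [tens_ext] (uniqueness).           *)
Section Tensor.
Variable k : fieldType.

Definition tens (U V : vectType k) : Type := 'M[k]_(dim U, dim V).
HB.instance Definition _ U V := Vector.copy (tens U V) 'M[k]_(dim U, dim V).

Definition tpure (U V : vectType k) (u : U) (v : V) : tens U V :=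
  (v2r u)^T *m v2r v.
Local Notation "u \ox v" := (tpure u v).

Definition tbase (U : vectType k) (i : 'I_(dim U)) : U := r2v (delta_mx 0 i).

(* The linear extension to U (x) V of b : U -> V -> W; meaningful when b is    *)
(* bilinear.                                                                   *)
Definition tens_lift (U V W : vectType k) (b : U -> V -> W) (t : tens U V) : W :=
  \sum_i \sum_j t i j *: b (tbase i) (tbase j).

Definition tens_map (U V U' V' : vectType k) (f : U -> U') (g : V -> V') :
  tens U V -> tens U' V' := tens_lift (fun u v => f u \ox g v).

Definition tens_assoc (U V W : vectType k) :
    tens (tens U V) W -> tens U (tens V W) :=
  tens_lift (fun t w => tens_lift (fun u v => u \ox (v \ox w)) t).

Definition tens_mul (A B : falgType k) (s t : tens A B) : tens A B :=
  tens_lift (fun a b => tens_lift (fun c d => (a * c) \ox (b * d)) t) s.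

Definition tensv (C : vectType k) (U V : {vspace C}) : {vspace tens C C} :=
  limg (linfun (tens_map (vsval : subvs_of U -> C) (vsval : subvs_of V -> C))).

Section Theory.
Implicit Types U V W X : vectType k.

Lemma tpureDl U V (v : V) a (u u' : U) :
  (a *: u + u') \ox v = a *: (u \ox v) + u' \ox v.
Proof. by rewrite /tpure !linearP /= mulmxDl -scalemxAl. Qed.

Lemma tpureDr U V (u : U) a (v v' : V) :
  u \ox (a *: v + v') = a *: (u \ox v) + u \ox v'.
Proof. by rewrite /tpure !linearP. Qed.

Lemma tpure_suml U V (I : finType) (F : I -> U) (v : V) :
  (\sum_i F i) \ox v = \sum_i F i \ox v.
Proof. by rewrite /tpure !linear_sum /= mulmx_suml. Qed.

Lemma tpure_sumr U V (I : finType) (u : U) (F : I -> V) :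
  u \ox (\sum_i F i) = \sum_i u \ox F i.
Proof. by rewrite /tpure !linear_sum. Qed.

Lemma tens_lift_is_linear U V W (b : U -> V -> W) : linear (tens_lift b).
Proof.
move=> a s t; rewrite /tens_lift scaler_sumr -big_split; apply: eq_bigr => i _.
rewrite scaler_sumr -big_split; apply: eq_bigr => j _ /=.
by rewrite !mxE scalerDl scalerA.
Qed.
HB.instance Definition _ U V W (b : U -> V -> W) :=
  GRing.isLinear.Build k (tens U V) W _ (tens_lift b) (tens_lift_is_linear b).
HB.instance Definition _ U V U' V' (f : U -> U') (g : V -> V') :=
  GRing.isLinear.Build k (tens U V) (tens U' V') _ (tens_map f g)
    (tens_lift_is_linear _).
HB.instance Definition _ U V W :=
  GRing.isLinear.Build k _ _ _ (@tens_assoc U V W) (tens_lift_is_linear _).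

Lemma tbase_sum U (u : U) : u = \sum_i v2r u 0 i *: tbase i.
Proof.
apply: v2r_inj; rewrite linear_sum [LHS]row_sum_delta.
by apply: eq_bigr => i _; rewrite linearZ /= /tbase r2vK.
Qed.

Lemma tens_liftE U V W (b : U -> V -> W) u v :
  (forall v, linear (b^~ v)) -> (forall u, linear (b u)) ->
  tens_lift b (u \ox v) = b u v.
Proof.
move=> bl br.
have blS (I : finType) (F : I -> k) (G : I -> U) w :
    b (\sum_i F i *: G i) w = \sum_i F i *: b (G i) w.
  pose bm := GRing.isLinear.Build k U W _ _ (bl w).
  pose f : {linear U -> W} := HB.pack (b^~ w) bm.
  rewrite -[LHS]/(f _) linear_sum; apply: eq_bigr => i _.
  by rewrite linearZ.
have brS (I : finType) (F : I -> k) (G : I -> V) w :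
    b w (\sum_i F i *: G i) = \sum_i F i *: b w (G i).
  pose bm := GRing.isLinear.Build k V W _ _ (br w).
  pose f : {linear V -> W} := HB.pack (b w) bm.
  rewrite -[LHS]/(f _) linear_sum; apply: eq_bigr => i _.
  by rewrite linearZ.
rewrite [in RHS](tbase_sum u) [in RHS](tbase_sum v) blS; apply: eq_bigr => i _.
rewrite brS scaler_sumr; apply: eq_bigr => j _.
by rewrite scalerA /tpure !mxE big_ord1 !mxE.
Qed.

Lemma tens_sum U V (t : tens U V) :
  t = \sum_i \sum_j t i j *: (tbase i \ox tbase j).
Proof.
rewrite [LHS]matrix_sum_delta; apply: eq_bigr => i _; apply: eq_bigr => j _.
congr (_ *: _); rewrite /tpure /tbase !r2vK trmx_delta.
by rewrite mul_delta_mx.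
Qed.

Lemma tens_ext U V W (f g : {linear tens U V -> W}) :
  (forall u v, f (u \ox v) = g (u \ox v)) -> f =1 g.
Proof.
move=> fg t; rewrite (tens_sum t) !linear_sum; apply: eq_bigr => i _.
by rewrite !linear_sum; apply: eq_bigr => j _; rewrite !linearZ fg.
Qed.

Lemma tens_mapE U V U' V' (f : {linear U -> U'}) (g : {linear V -> V'}) u v :
  tens_map f g (u \ox v) = f u \ox g v.
Proof.
rewrite /tens_map tens_liftE // => [w|w] a x y.
- by rewrite linearP tpureDl.
- by rewrite linearP tpureDr.
Qed.

Lemma tens_assocE U V W (u : U) (v : V) (w : W) :
  tens_assoc ((u \ox v) \ox w) = u \ox (v \ox w).
Proof.
have E w' u' v' :
    tens_lift (fun (u : U) (v : V) => u \ox (v \ox w')) (u' \ox v')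
    = u' \ox (v' \ox w').
  rewrite tens_liftE // => [z|z] a x y; first by rewrite tpureDl.
  by rewrite tpureDl tpureDr.
rewrite /tens_assoc tens_liftE ?E // => [z|t] a x y; first exact: linearP.
rewrite /tens_lift scaler_sumr -big_split; apply: eq_bigr => i _ /=.
rewrite scaler_sumr -big_split; apply: eq_bigr => j _ /=.
by rewrite !tpureDr scalerDr !scalerA mulrC.
Qed.

Lemma tens_mulE (A B : falgType k) (a c : A) (b d : B) :
  tens_mul (a \ox b) (c \ox d) = (a * c) \ox (b * d).
Proof.
have E a' b' (c' : A) (d' : B) :
    tens_lift (fun (c : A) (d : B) => (a' * c) \ox (b' * d)) (c' \ox d')
    = (a' * c') \ox (b' * d').
  rewrite tens_liftE // => [z|z] e x y.
  - by rewrite mulrDr -scalerAr tpureDl.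
  - by rewrite mulrDr -scalerAr tpureDr.
rewrite /tens_mul tens_liftE ?E // => [z|z] e x y; rewrite !E mulrDl -scalerAl.
- by rewrite tpureDl.
- by rewrite tpureDr.
Qed.

Lemma tens_map_id U V : tens_map idfun idfun =1 @id (tens U V).
Proof.
by apply: (tens_ext (f := tens_map idfun idfun) (g := idfun)) => u v;
   rewrite /= tens_mapE.
Qed.

Lemma tens_map_comp U V U' V' U2 V2 (f : {linear U' -> U2})
    (g : {linear V' -> V2}) (f' : {linear U -> U'}) (g' : {linear V -> V'}) t :
  tens_map f g (tens_map f' g' t) = tens_map (f \o f') (g \o g') t.
Proof.
apply: (tens_ext (f := tens_map f g \o tens_map f' g')
                 (g := tens_map (f \o f') (g \o g'))) => u v /=.
by rewrite !tens_mapE.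
Qed.

Lemma eq_tens_map U V U' V' (f f' : U -> U') (g g' : V -> V') :
  f =1 f' -> g =1 g' -> tens_map f g =1 tens_map f' g'.
Proof. by move=> /funext-> /funext->. Qed.

Lemma tens_ext3 U V W X (f g : {linear tens (tens U V) W -> X}) :
  (forall u v w, f ((u \ox v) \ox w) = g ((u \ox v) \ox w)) -> f =1 g.
Proof.
move=> fg; apply: tens_ext => s w.
have lw : linear (fun s : tens U V => s \ox w) by move=> a x y; rewrite tpureDl.
pose m := GRing.isLinear.Build k _ _ _ _ lw.
pose p : {linear tens U V -> tens (tens U V) W} :=
  HB.pack (fun s : tens U V => s \ox w) m.
apply: (tens_ext (f := f \o p) (g := g \o p)) => u v; exact: fg.
Qed.

Lemma tens_assoc_nat U V W U' V' W' (f : {linear U -> U'})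
    (g : {linear V -> V'}) (h : {linear W -> W'}) t :
  tens_assoc (tens_map (tens_map f g) h t)
  = tens_map f (tens_map g h) (tens_assoc t).
Proof.
apply: (tens_ext3 (f := @tens_assoc U' V' W' \o tens_map (tens_map f g) h)
  (g := tens_map f (tens_map g h) \o @tens_assoc U V W)) => u v w /=.
by do 2!rewrite !(tens_mapE, tens_assocE) /=.
Qed.

Lemma tens_lift_map U V U' V' W (b : U' -> V' -> W)
    (f : {linear U -> U'}) (g : {linear V -> V'}) t :
  (forall v, linear (b^~ v)) -> (forall u, linear (b u)) ->
  tens_lift b (tens_map f g t) = tens_lift (fun u v => b (f u) (g v)) t.
Proof.
move=> bl br.
apply: (tens_ext (f := tens_lift b \o tens_map f g)
  (g := tens_lift (fun u v => b (f u) (g v)))) => u v /=.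
by rewrite tens_mapE !tens_liftE // => w a x y; rewrite linearP (bl, br).
Qed.

Lemma linear_tens_lift U V W X (b : U -> V -> W) (h : {linear W -> X}) t :
  h (tens_lift b t) = tens_lift (fun u v => h (b u v)) t.
Proof.
rewrite /tens_lift linear_sum; apply: eq_bigr => i _; rewrite linear_sum.
by apply: eq_bigr => j _; rewrite linearZ.
Qed.

Lemma tensvP (C : vectType k) (U V : {vspace C}) (t : tens C C) :
  reflect (exists s : tens (subvs_of U) (subvs_of V), t = tens_map vsval vsval s)
          (t \in tensv U V).
Proof.
apply: (iffP memv_imgP) => [[s _ ->]|[s ->]]; exists s; rewrite ?memvf //.
- by rewrite lfunE.
- by rewrite lfunE.
Qed.

Lemma tpure_tensv (C : vectType k) (U V : {vspace C}) u v :
  u \in U -> v \in V -> u \ox v \in tensv U V.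
Proof.
move=> uU vV; apply/tensvP; exists (vsproj U u \ox vsproj V v).
by rewrite tens_mapE /= !vsprojK.
Qed.

Lemma tensvS (C : vectType k) (U V U' V' : {vspace C}) :
  (U <= U')%VS -> (V <= V')%VS -> (tensv U V <= tensv U' V')%VS.
Proof.
move=> /subvP sU /subvP sV; apply/subvP => _ /tensvP[s ->].
rewrite /tens_map /tens_lift; apply: memv_suml => i _; apply: memv_suml => j _.
by apply: memvZ; apply: tpure_tensv; [apply: sU|apply: sV]; apply: subvsP.
Qed.

End Theory.
End Tensor.
Notation "u \ox v" := (tpure u v) : ring_scope.


Section ComulMorphism.
Variables (k : fieldType) (C D : vectType k).
Variables (dC : {linear C -> tens C C}) (dD : {linear D -> tens D D}).
Variables (eC : {scalar C}) (eD : {scalar D}) (f : {linear C -> D}).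
Hypothesis fd : forall x, dD (f x) = tens_map f f (dC x).
Hypothesis fe : forall x, eD (f x) = eC x.

Lemma comulA_morphl x : tens_assoc (tens_map dD idfun (dD (f x)))
  = tens_map f (tens_map f f) (tens_assoc (tens_map dC idfun (dC x))).
Proof.
rewrite fd -tens_assoc_nat !tens_map_comp; congr (tens_assoc _).
by apply: eq_tens_map => y //=; rewrite fd.
Qed.

Lemma comulA_morphr x : tens_map idfun dD (dD (f x))
  = tens_map f (tens_map f f) (tens_map idfun dC (dC x)).
Proof.
by rewrite fd !tens_map_comp; apply: eq_tens_map => y //=; rewrite fd.
Qed.

Lemma counitl_morph x : tens_lift (fun a b => eD a *: b) (dD (f x))
  = f (tens_lift (fun a b => eC a *: b) (dC x)).
Proof.
rewrite fd tens_lift_map => [|v a y z|u a y z].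
- rewrite linear_tens_lift; congr (tens_lift _ _).
  by apply/funext => u; apply/funext => v; rewrite fe linearZ.
- by rewrite linearP /= scalerDl scalerA.
- by rewrite scalerDr !scalerA mulrC.
Qed.

Lemma counitr_morph x : tens_lift (fun a b => eD b *: a) (dD (f x))
  = f (tens_lift (fun a b => eC b *: a) (dC x)).
Proof.
rewrite fd tens_lift_map => [|v a y z|u a y z].
- rewrite linear_tens_lift; congr (tens_lift _ _).
  by apply/funext => u; apply/funext => v; rewrite fe linearZ.
- by rewrite scalerDr !scalerA mulrC.
- by rewrite linearP /= scalerDl scalerA.
Qed.

End ComulMorphism.

HB.mixin Record Vector_isCoalgebra (k : fieldType) C of Vector k C := {
  comul : {linear C -> tens C C};
  counit : {scalar C};
  comulA : forall x : C,
    tens_assoc (tens_map comul idfun (comul x)) = tens_map idfun comul (comul x);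
  counitl : forall x : C, tens_lift (fun a b : C => counit a *: b) (comul x) = x;
  counitr : forall x : C, tens_lift (fun a b : C => counit b *: a) (comul x) = x
}.

#[short(type="coalgType")]
HB.structure Definition Coalgebra (k : fieldType) :=
  {C of Vector k C & Vector_isCoalgebra k C}.

HB.mixin Record Falgebra_Coalgebra_isBialgebra (k : fieldType) H
    of Falgebra k H & Coalgebra k H := {
  comulM : forall x y : H, comul (x * y) = tens_mul (comul x) (comul y);
  comul1 : comul (1 : H) = 1 \ox 1;
  counitM : forall x y : H, counit (x * y) = counit x * counit y;
  counit1 : counit (1 : H) = 1
}.

#[short(type="bialgType")]
HB.structure Definition Bialgebra (k : fieldType) :=
  {H of Falgebra k H & Coalgebra k H & Falgebra_Coalgebra_isBialgebra k H}.

HB.mixin Record Bialgebra_isHopfAlgebra (k : fieldType) H of Bialgebra k H := {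
  antipode : {linear H -> H};
  antipodel : forall x : H,
    tens_lift (fun a b : H => antipode a * b) (comul x) = counit x *: 1;
  antipoder : forall x : H,
    tens_lift (fun a b : H => a * antipode b) (comul x) = counit x *: 1
}.

#[short(type="hopfAlgType")]
HB.structure Definition HopfAlgebra (k : fieldType) :=
  {H of Bialgebra k H & Bialgebra_isHopfAlgebra k H}.

Definition coalg_iso (k : fieldType) (C D : coalgType k) : Prop :=
  exists f : {linear C -> D},
    [/\ bijective f,
        forall x, comul (f x) = tens_map f f (comul x)
      & forall x, counit (f x) = counit x].

Section MatrixCoalgebra.
Variables (n : nat) (k : fieldType).

(* M^c(n, k), with delta_mx i j in the role of e_ij. *)
Definition mxcoalg : Type := 'M[k]_n.
HB.instance Definition _ := Vector.copy mxcoalg 'M[k]_n.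

Definition mxcoalg_basis (i j : 'I_n) : mxcoalg := delta_mx i j.
Local Notation e := mxcoalg_basis.

Definition mxcoalg_comul (A : mxcoalg) : tens mxcoalg mxcoalg :=
  \sum_i \sum_j A i j *: \sum_r (e i r \ox e r j).

Definition mxcoalg_counit (A : mxcoalg) : k :=
  \sum_i \sum_j A i j * (i == j)%:R.

Lemma mxcoalg_comul_is_linear : linear mxcoalg_comul.
Proof.
move=> a A B; rewrite /mxcoalg_comul scaler_sumr -big_split.
apply: eq_bigr => i _; rewrite scaler_sumr -big_split; apply: eq_bigr => j _ /=.
by rewrite !mxE scalerDl scalerA.
Qed.
HB.instance Definition _ :=
  GRing.isLinear.Build k mxcoalg _ _ mxcoalg_comul mxcoalg_comul_is_linear.

Lemma mxcoalg_counit_is_scalar : scalar mxcoalg_counit.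
Proof.
move=> a A B; rewrite /mxcoalg_counit mulr_sumr -big_split.
apply: eq_bigr => i _; rewrite mulr_sumr -big_split; apply: eq_bigr => j _ /=.
by rewrite !mxE mulrDl mulrA.
Qed.
HB.instance Definition _ :=
  GRing.isLinear.Build k mxcoalg _ _ mxcoalg_counit mxcoalg_counit_is_scalar.

Lemma mxcoalg_comulE i j : mxcoalg_comul (e i j) = \sum_r (e i r \ox e r j).
Proof.
rewrite /mxcoalg_comul (bigD1 i) //= [X in _ + X]big1 => [|a /negPf ai]; last first.
  by rewrite big1 // => b _; rewrite mxE ai scale0r.
rewrite addr0 (bigD1 j) //= [X in _ + X]big1 => [|b /negPf bj]; last first.
  by rewrite mxE bj andbF scale0r.
by rewrite addr0 mxE !eqxx scale1r.
Qed.

Lemma mxcoalg_counitE i j : mxcoalg_counit (e i j) = (i == j)%:R.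
Proof.
rewrite /mxcoalg_counit (bigD1 i) //= [X in _ + X]big1 => [|a /negPf ai]; last first.
  by rewrite big1 // => b _; rewrite mxE ai mul0r.
rewrite addr0 (bigD1 j) //= [X in _ + X]big1 => [|b /negPf bj]; last first.
  by rewrite mxE bj andbF mul0r.
by rewrite addr0 mxE !eqxx mul1r.
Qed.

Lemma mxcoalg_ext (W : vectType k) (f g : {linear mxcoalg -> W}) :
  (forall i j, f (e i j) = g (e i j)) -> f =1 g.
Proof.
move=> fg A; have ->: A = \sum_i \sum_j A i j *: e i j :> mxcoalg.
  exact: matrix_sum_delta.
rewrite !linear_sum; apply: eq_bigr => i _.
by rewrite !linear_sum; apply: eq_bigr => j _; rewrite !linearZ fg.
Qed.

Lemma mxcoalg_comulA (A : mxcoalg) :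
  tens_assoc (tens_map mxcoalg_comul idfun (mxcoalg_comul A))
  = tens_map idfun mxcoalg_comul (mxcoalg_comul A).
Proof.
apply: (mxcoalg_ext (f := @tens_assoc _ _ _ _ \o
   (tens_map mxcoalg_comul idfun \o mxcoalg_comul))
  (g := tens_map idfun mxcoalg_comul \o mxcoalg_comul)) => i j /=.
rewrite mxcoalg_comulE (linear_sum (tens_map mxcoalg_comul idfun)).
rewrite (linear_sum (tens_map idfun mxcoalg_comul)).
rewrite (linear_sum (@tens_assoc _ _ _ _)) /=.
under [LHS]eq_bigr => r _.
  rewrite tens_mapE /= mxcoalg_comulE tpure_suml (linear_sum (@tens_assoc _ _ _ _)).
  under eq_bigr => s _ do rewrite /= tens_assocE.
  over.
under [RHS]eq_bigr => r _ do rewrite tens_mapE /= mxcoalg_comulE tpure_sumr.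
exact: exchange_big.
Qed.

Lemma mxcoalg_counitl (A : mxcoalg) :
  tens_lift (fun a b : mxcoalg => mxcoalg_counit a *: b) (mxcoalg_comul A) = A.
Proof.
apply: (mxcoalg_ext (g := idfun) (f := tens_lift
  (fun a b : mxcoalg => mxcoalg_counit a *: b) \o mxcoalg_comul)) => i j /=.
rewrite mxcoalg_comulE linear_sum (bigD1 i) //= [X in _ + X]big1 => [|r ri].
  rewrite addr0 tens_liftE => [|v a x y|u a x y].
  - by rewrite mxcoalg_counitE eqxx scale1r.
  - by rewrite linearP /= scalerDl scalerA.
  - by rewrite scalerDr !scalerA mulrC.
rewrite tens_liftE => [|v a x y|u a x y].
- by rewrite mxcoalg_counitE eq_sym (negPf ri) scale0r.
- by rewrite linearP /= scalerDl scalerA.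
- by rewrite scalerDr !scalerA mulrC.
Qed.

Lemma mxcoalg_counitr (A : mxcoalg) :
  tens_lift (fun a b : mxcoalg => mxcoalg_counit b *: a) (mxcoalg_comul A) = A.
Proof.
apply: (mxcoalg_ext (g := idfun) (f := tens_lift
  (fun a b : mxcoalg => mxcoalg_counit b *: a) \o mxcoalg_comul)) => i j /=.
rewrite mxcoalg_comulE linear_sum (bigD1 j) //= [X in _ + X]big1 => [|r rj].
  rewrite addr0 tens_liftE => [|v a x y|u a x y].
  - by rewrite mxcoalg_counitE eqxx scale1r.
  - by rewrite scalerDr !scalerA mulrC.
  - by rewrite linearP /= scalerDl scalerA.
rewrite tens_liftE => [|v a x y|u a x y].
- by rewrite mxcoalg_counitE (negPf rj) scale0r.
- by rewrite scalerDr !scalerA mulrC.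
- by rewrite linearP /= scalerDl scalerA.
Qed.

HB.instance Definition _ := Vector_isCoalgebra.Build k mxcoalg
  mxcoalg_comulA mxcoalg_counitl mxcoalg_counitr.

End MatrixCoalgebra.

Section DirectSum.
Variables (k : fieldType) (C D : coalgType k).

Definition coalg_inl (c : C) : C * D := (c, 0).
Definition coalg_inr (d : D) : C * D := (0, d).
Local Notation inl := coalg_inl.
Local Notation inr := coalg_inr.

Lemma coalg_inl_is_linear : linear inl.
Proof. by move=> a x y; congr pair; rewrite /= scaler0 addr0. Qed.
HB.instance Definition _ :=
  GRing.isLinear.Build k C _ _ inl coalg_inl_is_linear.

Lemma coalg_inr_is_linear : linear inr.
Proof. by move=> a x y; congr pair; rewrite /= scaler0 addr0. Qed.
HB.instance Definition _ :=
  GRing.isLinear.Build k D _ _ inr coalg_inr_is_linear.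

Definition dsum_comul (x : C * D) : tens (C * D)%type (C * D)%type :=
  tens_map inl inl (comul x.1) + tens_map inr inr (comul x.2).

Definition dsum_counit (x : C * D) : k := counit x.1 + counit x.2.

Lemma dsum_comul_is_linear : linear dsum_comul.
Proof.
move=> a x y; rewrite /dsum_comul !linearP /= scalerDr.
exact: addrACA.
Qed.
HB.instance Definition _ :=
  GRing.isLinear.Build k (C * D)%type _ _ dsum_comul dsum_comul_is_linear.

Lemma dsum_counit_is_scalar : scalar dsum_counit.
Proof. by move=> a x y; rewrite /dsum_counit !linearP /= mulrDr addrACA. Qed.
HB.instance Definition _ :=
  GRing.isLinear.Build k (C * D)%type _ _ dsum_counit dsum_counit_is_scalar.

Let dl c : dsum_comul (inl c) = tens_map inl inl (comul c).
Proof. by rewrite /dsum_comul /= !linear0 addr0. Qed.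
Let dr d : dsum_comul (inr d) = tens_map inr inr (comul d).
Proof. by rewrite /dsum_comul /= !linear0 add0r. Qed.
Let el c : dsum_counit (inl c) = counit c.
Proof. by rewrite /dsum_counit /= linear0 addr0. Qed.
Let er d : dsum_counit (inr d) = counit d.
Proof. by rewrite /dsum_counit /= linear0 add0r. Qed.

Lemma dsum_ext (W : vectType k) (f g : {linear (C * D)%type -> W}) :
  (forall c, f (inl c) = g (inl c)) -> (forall d, f (inr d) = g (inr d)) ->
  f =1 g.
Proof.
move=> fgl fgr x; suff ->: x = inl x.1 + inr x.2 by rewrite !linearD fgl fgr.
by case: x => c d; congr pair; rewrite /= ?addr0 ?add0r.
Qed.

Lemma dsum_comulA x :
  tens_assoc (tens_map dsum_comul idfun (dsum_comul x))
  = tens_map idfun dsum_comul (dsum_comul x).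
Proof.
apply: (dsum_ext (f := @tens_assoc _ _ _ _ \o
   (tens_map dsum_comul idfun \o dsum_comul))
  (g := tens_map idfun dsum_comul \o dsum_comul)) => [c|d].
- apply: etrans (comulA_morphl dl c) _; rewrite comulA.
  exact: esym (comulA_morphr dl c).
- apply: etrans (comulA_morphl dr d) _; rewrite comulA.
  exact: esym (comulA_morphr dr d).
Qed.

Lemma dsum_counitl x :
  tens_lift (fun a b => dsum_counit a *: b) (dsum_comul x) = x.
Proof.
apply: (dsum_ext (g := idfun)
  (f := tens_lift (fun a b => dsum_counit a *: b) \o dsum_comul)) => [c|d].
- by apply: etrans (counitl_morph dl el c) _; rewrite counitl.
- by apply: etrans (counitl_morph dr er d) _; rewrite counitl.
Qed.

Lemma dsum_counitr x :
  tens_lift (fun a b => dsum_counit b *: a) (dsum_comul x) = x.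
Proof.
apply: (dsum_ext (g := idfun)
  (f := tens_lift (fun a b => dsum_counit b *: a) \o dsum_comul)) => [c|d].
- by apply: etrans (counitr_morph dl el c) _; rewrite counitr.
- by apply: etrans (counitr_morph dr er d) _; rewrite counitr.
Qed.

HB.instance Definition _ := Vector_isCoalgebra.Build k (C * D)%type
  dsum_comulA dsum_counitl dsum_counitr.

End DirectSum.

Section Subcoalgebra.
Variables (k : fieldType) (C : coalgType k).
Implicit Types U S T : {vspace C}.

Definition is_subcoalg U : bool := (linfun comul @: U <= tensv U U)%VS.

Lemma is_subcoalgP U :
  reflect (forall x, x \in U -> comul x \in tensv U U) (is_subcoalg U).
Proof.
apply: (iffP subvP) => [sU x xU|sU _ /memv_imgP[x xU ->]].
- by rewrite -[comul x](lfunE comul) sU // memv_img.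
- by rewrite lfunE sU.
Qed.

Record subcoalg := Subcoalg {
  subcoalg_space :> {vspace C};
  subcoalgP : is_subcoalg subcoalg_space
}.

Definition subcoalg_of (D : subcoalg) : Type := subvs_of D.

Section Structure.
Variable D : subcoalg.
HB.instance Definition _ := Vector.copy (subcoalg_of D) (subvs_of D).

(* The corestriction of comul to D (x) D along D (x) D -> C (x) C; this        *)
(* inclusion is injective, and [subcoalg_comulE] characterizes the result.     *)
Definition subcoalg_comul (x : subcoalg_of D) :
    tens (subcoalg_of D) (subcoalg_of D) :=
  tens_map (vsproj D) (vsproj D) (comul (vsval x)).
Definition subcoalg_counit (x : subcoalg_of D) : k := counit (vsval x).

Let i : {linear subcoalg_of D -> C} := (vsval : subvs_of D -> C).
Let p : {linear C -> subcoalg_of D} := vsproj D.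
Let iK : p \o i = idfun. Proof. by apply/funext => x; apply: vsvalK. Qed.

Lemma subcoalg_comul_is_linear : linear subcoalg_comul.
Proof. by move=> a x y; rewrite /subcoalg_comul !linearP. Qed.
HB.instance Definition _ :=
  GRing.isLinear.Build k (subcoalg_of D) _ _ subcoalg_comul
    subcoalg_comul_is_linear.

Lemma subcoalg_counit_is_scalar : scalar subcoalg_counit.
Proof. by move=> a x y; rewrite /subcoalg_counit !linearP. Qed.
HB.instance Definition _ :=
  GRing.isLinear.Build k (subcoalg_of D) _ _ subcoalg_counit
    subcoalg_counit_is_scalar.

Lemma subcoalg_comulE (x : subcoalg_of D) :
  comul (vsval x) = tens_map i i (subcoalg_comul x).
Proof.
have /tensvP[t xt] := is_subcoalgP _ (subcoalgP D) _ (subvsP x).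
rewrite xt /subcoalg_comul xt (tens_map_comp p p i i) iK.
by rewrite tens_map_id.
Qed.

Let ce (x : subcoalg_of D) : counit (i x) = subcoalg_counit x.
Proof. by []. Qed.

Lemma subcoalg_comulA (x : subcoalg_of D) :
  tens_assoc (tens_map subcoalg_comul idfun (subcoalg_comul x))
  = tens_map idfun subcoalg_comul (subcoalg_comul x).
Proof.
have inj : injective (tens_map i (tens_map i i)).
  apply: (can_inj (g := tens_map p (tens_map p p))) => t.
  rewrite tens_map_comp iK (eq_tens_map (f' := idfun) (g' := idfun)) //.
    exact: tens_map_id.
  by move=> s /=; rewrite tens_map_comp iK tens_map_id.
apply: inj.
rewrite -(comulA_morphl subcoalg_comulE) -(comulA_morphr subcoalg_comulE).
exact: comulA.
Qed.

Lemma subcoalg_counitl (x : subcoalg_of D) :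
  tens_lift (fun a b => subcoalg_counit a *: b) (subcoalg_comul x) = x.
Proof.
apply: (can_inj (@vsvalK _ _ D)).
rewrite -[LHS](counitl_morph subcoalg_comulE ce); exact: counitl.
Qed.

Lemma subcoalg_counitr (x : subcoalg_of D) :
  tens_lift (fun a b => subcoalg_counit b *: a) (subcoalg_comul x) = x.
Proof.
apply: (can_inj (@vsvalK _ _ D)).
rewrite -[LHS](counitr_morph subcoalg_comulE ce); exact: counitr.
Qed.

HB.instance Definition _ := Vector_isCoalgebra.Build k (subcoalg_of D)
  subcoalg_comulA subcoalg_counitl subcoalg_counitr.
End Structure.

Definition simple_subcoalg S : Prop :=
  [/\ is_subcoalg S, S != 0%VS
    & forall T, is_subcoalg T -> (T <= S)%VS -> T = 0%VS \/ T = S].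

(* U is the sum of all simple subcoalgebras; as dim C is finite, this sum is   *)
(* attained by a finite family.                                                *)
Definition is_coradical U : Prop :=
  (forall S, simple_subcoalg S -> (S <= U)%VS) /\
  exists2 s : seq {vspace C},
    {in s, forall S, simple_subcoalg S} & U = (\sum_(S <- s) S)%VS.

Lemma is_coradical_uniq U V : is_coradical U -> is_coradical V -> U = V.
Proof.
have half A B : is_coradical A -> is_coradical B -> (A <= B)%VS.
  move=> [_ [s sS ->]] [B1 _]; elim: s sS => [|S s IH] sS.
    by rewrite big_nil sub0v.
  rewrite big_cons subv_add (B1 S) ?IH //; last by apply: sS; apply: mem_head.
  by move=> T Ts; apply: sS; rewrite inE Ts orbT.
by move=> cU cV; apply: subv_anti; rewrite !half.
Qed.

Lemma is_coradical_ex : exists U, is_coradical U.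
Proof.
pose P n := `[< exists2 s : seq {vspace C},
  {in s, forall S, simple_subcoalg S} & n = \dim (\sum_(S <- s) S)%VS >].
have P0 : exists n, P n by exists 0%N; apply/asboolP; exists [::];
  rewrite // big_nil dimv0.
have Pb n : P n -> (n <= \dim {:C})%N.
  by move=> /asboolP[s _ ->]; apply: dimvS; apply: subvf.
case: (ex_maxnP P0 Pb) => n /asboolP[s sS ->] max.
exists (\sum_(S <- s) S)%VS; split; last by exists s.
move=> S simS; apply/addv_idPr; apply/esym/eqP; rewrite eqEdim addvSr /=.
apply: max; apply/asboolP; exists (S :: s); last by rewrite big_cons.
by move=> T; rewrite inE => /predU1P[->|/sS].
Qed.

Definition coradical_space : {vspace C} := xget 0%VS [set U | is_coradical U].

Lemma coradical_spaceP : is_coradical coradical_space.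
Proof. by have [U cU] := is_coradical_ex; apply: (xgetPex 0%VS); exists U. Qed.

Lemma is_subcoalg0 : is_subcoalg 0%VS.
Proof. by apply/is_subcoalgP => x; rewrite memv0 => /eqP->; rewrite linear0 mem0v. Qed.

Lemma is_subcoalgD U V : is_subcoalg U -> is_subcoalg V -> is_subcoalg (U + V)%VS.
Proof.
move=> /is_subcoalgP cU /is_subcoalgP cV; apply/is_subcoalgP => _ /memv_addP[u uU [v vV ->]].
rewrite linearD memvD //.
- exact: subvP (tensvS (addvSl U V) (addvSl U V)) _ (cU u uU).
- exact: subvP (tensvS (addvSr U V) (addvSr U V)) _ (cV v vV).
Qed.

Lemma coradical_subproof : is_subcoalg coradical_space.
Proof.
have [_ [s sS ->]] := coradical_spaceP; elim: s sS => [|S s IH] sS.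
  by rewrite big_nil is_subcoalg0.
rewrite big_cons is_subcoalgD //.
- by have [] := sS S (mem_head _ _).
- by apply: IH => T Ts; apply: sS; rewrite inE Ts orbT.
Qed.

Definition coradical : subcoalg := Subcoalg coradical_subproof.

End Subcoalgebra.

Section UnitSubcoalgebra.
Variables (k : fieldType) (H : bialgType k).

Lemma unit_subproof : is_subcoalg <[1 : H]>%VS.
Proof.
apply/is_subcoalgP => _ /vlineP[a ->]; rewrite linearZ /= memvZ // comul1.
by rewrite tpure_tensv // memv_line.
Qed.

Definition unit_subcoalg : subcoalg H := Subcoalg unit_subproof.

End UnitSubcoalgebra.

(* Main.v *)
Require Import Defs.
From HB Require Import structures.
From mathcomp Require Import all_boot all_order all_algebra all_field.
From mathcomp Require Import boolp zify.

(* A comodule is handled through its corepresentation matrix T over H, and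
   Burnside's theorem makes every corepresentation block triangular with
   irreducible diagonal blocks, whose coefficients span simple subcoalgebras.

   Excluding (ii), (iii), (iv).  Let lam be a nonzero integral on H and T an
   irreducible corepresentation of size n > 1.  The functionals
   lam (S(t_ij) -) are linearly independent, so if n^2 > dim H - dim H0 one of
   them is nonzero on the coradical H0.  This makes the comodule of T a direct
   summand of H, and, applying the same to the dual of T, the coefficients of T
   form a direct factor of the coalgebra H.  In these three cases this splits off
   every matrix block of H0, and what remains is a coalgebra whose only simple
   subcoalgebra is k 1.  As there are no nonzero primitive elements in
   characteristic 0, it is k 1, so H = H0, against the dimension.

   Excluding (i).  Let chi be the character of the two-dimensional simple
   comodule V.  Every comodule has character a + b chi with natural a and b;
   if b = 0 the comodule is trivial, again for lack of primitive elements.  Write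
   a + b chi for the character of H, so that a + 2 b = 16 and a > 0, and
   chi^2 = m + l chi for that of the tensor product of V with its dual, so that
   m + 2 l = 4, and l > 0 since that product is not trivial.  Multiplying by chi
   doubles the character of H, whence b m = 2 a and a + b l = 2 b.  This forces
   m = 2, l = 1 and 3 a = 16. *)

Set Implicit Arguments.
Unset Strict Implicit.
Unset Printing Implicit Defensive.

Import GRing.Theory VectorInternalTheory.

Local Open Scope ring_scope.

(** * The tensor product algebra and the comultiplication as a ring morphism *)

Section TensorZero.
Variables (k : fieldType) (U V : vectType k).

Lemma tpure0l (v : V) : (0 : U) \ox v = 0.
Proof. by rewrite /tpure !linear0 mul0mx. Qed.

Lemma tpure0r (u : U) : u \ox (0 : V) = 0.
Proof. by rewrite /tpure linear0 mulmx0. Qed.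

End TensorZero.

Section TensorRing.
Variables (k : fieldType) (A B : falgType k).

(** The arguments are swapped so that multiplication by a fixed right factor carries a linear
    structure. *)
Definition tens_mull (t s : tens A B) := tens_mul s t.

Lemma tens_mul_linearl (t : tens A B) : linear (tens_mull t).
Proof. exact: tens_lift_is_linear. Qed.

Lemma tens_mul_linearr (s : tens A B) : linear (tens_mul s).
Proof.
move=> a t u; rewrite /tens_mul {1 3 5}/tens_lift scaler_sumr -big_split.
apply: eq_bigr => i _ /=; rewrite scaler_sumr -big_split; apply: eq_bigr => j _ /=.
rewrite tens_lift_is_linear.
by rewrite scalerDr !scalerA mulrC.
Qed.

HB.instance Definition _ t := GRing.isLinear.Build k (tens A B) (tens A B) _
  (tens_mull t) (tens_mul_linearl t).
HB.instance Definition _ s := GRing.isLinear.Build k (tens A B) (tens A B) _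
  (tens_mul s) (tens_mul_linearr s).

Lemma tens_mulA : associative (@tens_mul k A B).
Proof.
move=> s t u.
apply: (tens_ext (f := tens_mull (tens_mul t u))
  (g := tens_mull u \o tens_mull t)) => a b /=.
apply: (tens_ext (f := tens_mul (a \ox b) \o tens_mull u)
  (g := tens_mull u \o tens_mul (a \ox b))) => c d /=.
apply: (tens_ext (f := tens_mul (a \ox b) \o tens_mul (c \ox d))
  (g := tens_mul (tens_mul (a \ox b) (c \ox d)))) => e f /=.
by rewrite /tens_mull !tens_mulE !mulrA.
Qed.

Lemma tens_mul1r : left_id ((1 : A) \ox (1 : B)) (@tens_mul k A B).
Proof.
by apply: (tens_ext (f := tens_mul (1 \ox 1)) (g := idfun)) => a b;
  rewrite /= tens_mulE !mul1r.
Qed.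

Lemma tens_mulr1 : right_id ((1 : A) \ox (1 : B)) (@tens_mul k A B).
Proof.
by apply: (tens_ext (f := tens_mull (1 \ox 1)) (g := idfun)) => a b;
  rewrite /= /tens_mull tens_mulE !mulr1.
Qed.

Lemma tens_mulDl : left_distributive (@tens_mul k A B) +%R.
Proof. by move=> s t u; exact: (linearD (tens_mull u)). Qed.

Lemma tens_mulDr : right_distributive (@tens_mul k A B) +%R.
Proof. by move=> s t u; rewrite linearD. Qed.

End TensorRing.

(** An alias carrying the ring structure of the tensor product, so that matrix products and ring
    morphisms can be used with entries in it. *)
Definition tens_ring (k : fieldType) (A B : falgType k) : Type := tens A B.
HB.instance Definition _ (k : fieldType) (A B : falgType k) :=
  Vector.copy (tens_ring A B) (tens A B).
HB.instance Definition _ (k : fieldType) (A B : falgType k) :=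
  GRing.Zmodule_isPzRing.Build (tens_ring A B) (@tens_mulA k A B)
    (@tens_mul1r k A B) (@tens_mulr1 k A B) (@tens_mulDl k A B)
    (@tens_mulDr k A B).

Section TensorMorphisms.
Variables (k : fieldType) (H : bialgType k).

(** [tens_inl], [tens_inr] and [comul_ring] are ring morphisms. Mapped over matrix entries, they
    turn the comultiplication rule of a corepresentation into one matrix equation, [comul_mxP]. *)
Definition tens_inl (x : H) : tens_ring H H := x \ox 1.
Definition tens_inr (x : H) : tens_ring H H := 1 \ox x.
Definition comul_ring : H -> tens_ring H H := comul.

Lemma tens_inl_linear : linear tens_inl.
Proof. by move=> a x y; rewrite /tens_inl tpureDl. Qed.
Lemma tens_inr_linear : linear tens_inr.
Proof. by move=> a x y; rewrite /tens_inr tpureDr. Qed.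
Lemma comul_ring_linear : linear comul_ring.
Proof. by move=> a x y; rewrite /comul_ring linearP. Qed.

HB.instance Definition _ :=
  GRing.isLinear.Build k H (tens_ring H H) _ tens_inl tens_inl_linear.
HB.instance Definition _ :=
  GRing.isLinear.Build k H (tens_ring H H) _ tens_inr tens_inr_linear.
HB.instance Definition _ :=
  GRing.isLinear.Build k H (tens_ring H H) _ comul_ring comul_ring_linear.

Lemma tens_inl_monoid : monoid_morphism tens_inl.
Proof.
by split=> // x y; rewrite -[RHS]/(tens_mul _ _) tens_mulE mulr1.
Qed.
Lemma tens_inr_monoid : monoid_morphism tens_inr.
Proof.
by split=> // x y; rewrite -[RHS]/(tens_mul _ _) tens_mulE mulr1.
Qed.
Lemma comul_ring_monoid : monoid_morphism comul_ring.
Proof. by split=> [|x y]; [apply: comul1 | apply: comulM]. Qed.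

HB.instance Definition _ :=
  GRing.isMonoidMorphism.Build H (tens_ring H H) tens_inl tens_inl_monoid.
HB.instance Definition _ :=
  GRing.isMonoidMorphism.Build H (tens_ring H H) tens_inr tens_inr_monoid.
HB.instance Definition _ :=
  GRing.isMonoidMorphism.Build H (tens_ring H H) comul_ring comul_ring_monoid.

Lemma tens_inlr x y : tens_inl x * tens_inr y = x \ox y.
Proof. by rewrite -[LHS]/(tens_mul _ _) tens_mulE mulr1 mul1r. Qed.
Lemma tens_inrl x y : tens_inr y * tens_inl x = x \ox y.
Proof. by rewrite -[LHS]/(tens_mul _ _) tens_mulE mulr1 mul1r. Qed.

End TensorMorphisms.

(** * The actions of the dual algebra on a coalgebra *)

Section Hits.
Variables (k : fieldType) (H : coalgType k).
Implicit Types f g : {scalar H}.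

(** In Sweedler notation [hitl f x] is f(x_1) x_2 and [hitr f x] is x_1 f(x_2). The convolution
    product f * g of the dual algebra is [g \o hitl f]. *)
Definition hitl (f : H -> k) (x : H) : H := tens_lift (fun a b => f a *: b) (comul x).
Definition hitr (f : H -> k) (x : H) : H := tens_lift (fun a b => f b *: a) (comul x).

Lemma hitl_linear f : linear (hitl f).
Proof. by move=> a x y; rewrite /hitl !linearP. Qed.
Lemma hitr_linear f : linear (hitr f).
Proof. by move=> a x y; rewrite /hitr !linearP. Qed.
HB.instance Definition _ f := GRing.isLinear.Build k H H _ (hitl f) (hitl_linear f).
HB.instance Definition _ f := GRing.isLinear.Build k H H _ (hitr f) (hitr_linear f).

Lemma tens_hitlE (U V : vectType k) (f : {scalar U}) (a : U) (b : V) :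
  tens_lift (fun a b => f a *: b) (a \ox b) = f a *: b.
Proof.
rewrite tens_liftE // => [v c x y|u c x y].
- by rewrite linearP /= scalerDl scalerA.
- by rewrite scalerDr !scalerA mulrC.
Qed.

Lemma tens_hitrE f a b : tens_lift (fun a b : H => f b *: a) (a \ox b) = f b *: a.
Proof.
rewrite tens_liftE // => [v c x y|u c x y].
- by rewrite scalerDr !scalerA mulrC.
- by rewrite linearP /= scalerDl scalerA.
Qed.

Lemma hitl_sum f x (I : finType) (a b : I -> H) :
  comul x = \sum_i a i \ox b i -> hitl f x = \sum_i f (a i) *: b i.
Proof.
move=> dx; rewrite /hitl dx linear_sum.
by apply: eq_bigr => i _; rewrite /= tens_hitlE.
Qed.

Lemma hitr_sum f x (I : finType) (a b : I -> H) :
  comul x = \sum_i a i \ox b i -> hitr f x = \sum_i f (b i) *: a i.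
Proof.
move=> dx; rewrite /hitr dx linear_sum.
by apply: eq_bigr => i _; rewrite /= tens_hitrE.
Qed.

Lemma hitl_counit x : hitl counit x = x. Proof. exact: counitl. Qed.
Lemma hitr_counit x : hitr counit x = x. Proof. exact: counitr. Qed.

(** The dual basis of [tbase]. *)
Definition coordf (i : 'I_(dim H)) (x : H) : k := v2r x 0 i.
Lemma coordf_scalar i : scalar (coordf i).
Proof. by move=> a x y; rewrite /coordf linearP !mxE. Qed.
HB.instance Definition _ i :=
  GRing.isLinear.Build k H k _ (coordf i) (coordf_scalar i).

Lemma coordf_sum x : x = \sum_i coordf i x *: tbase i.
Proof. exact: tbase_sum. Qed.

Lemma coordf_base i j : coordf i (tbase j) = (i == j)%:R.
Proof. by rewrite /coordf /tbase r2vK mxE eqxx. Qed.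

Lemma coordf_ext x y : (forall i, coordf i x = coordf i y) -> x = y.
Proof. by move=> xy; rewrite (coordf_sum x) (coordf_sum y); apply: eq_bigr => i _; rewrite xy. Qed.

Lemma functional_ext x y : (forall f, f x = f y) -> x = y.
Proof. by move=> xy; apply: coordf_ext => i; apply: xy. Qed.

Lemma comul_base x : comul x = \sum_i tbase i \ox hitl (coordf i) x.
Proof.
rewrite {1}(tens_sum (comul x)); apply: eq_bigr => i _.
have -> : hitl (coordf i) x = \sum_j comul x i j *: tbase j.
  rewrite /hitl /tens_lift (bigD1 i) //= [X in _ + X]big1 ?addr0 => [|a /negPf ai].
    by apply: eq_bigr => j _; rewrite coordf_base eqxx scale1r.
  by rewrite big1 // => b _; rewrite coordf_base eq_sym ai scale0r scaler0.
rewrite tpure_sumr; apply: eq_bigr => j _.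
by rewrite /tpure linearZ /= -scalemxAr.
Qed.

(** Both sides are the convolution f * g evaluated at x. *)
Lemma hit_adj f g x : g (hitl f x) = f (hitr g x).
Proof.
rewrite (hitl_sum _ (comul_base x)) (hitr_sum _ (comul_base x)) !linear_sum.
by apply: eq_bigr => i _; rewrite !linearZ /= mulrC.
Qed.

End Hits.

(** * Corepresentation matrices and the regular corepresentation *)

Section ScalarMatrices.
Variables (k : fieldType) (H : falgType k).

Definition smx m n (P : 'M[k]_(m, n)) : 'M[H]_(m, n) := map_mx (in_alg H) P.

Lemma smxM m n p (P : 'M[k]_(m, n)) (Q : 'M[k]_(n, p)) :
  smx (P *m Q) = smx P *m smx Q.
Proof. exact: map_mxM. Qed.

Lemma smx1 n : smx (1%:M : 'M[k]_n) = 1%:M.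
Proof. exact: map_mx1. Qed.

Lemma smx0 m n : smx (0 : 'M[k]_(m, n)) = 0.
Proof. exact: map_mx0. Qed.

Lemma smx_mulE m n p (P : 'M[k]_(m, n)) (T : 'M[H]_(n, p)) i j :
  (smx P *m T) i j = \sum_r P i r *: T r j.
Proof. by rewrite mxE; apply: eq_bigr => r _; rewrite mxE mulr_algl. Qed.

Lemma mul_smxE m n p (T : 'M[H]_(m, n)) (P : 'M[k]_(n, p)) i j :
  (T *m smx P) i j = \sum_r P r j *: T i r.
Proof. by rewrite mxE; apply: eq_bigr => r _; rewrite mxE mulr_algr. Qed.

Lemma map_smx_mul m n p (f : {scalar H}) (P : 'M[k]_(m, n)) (T : 'M[H]_(n, p)) :
  map_mx f (smx P *m T) = P *m map_mx f T.
Proof.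
apply/matrixP => i j; rewrite mxE smx_mulE linear_sum mxE.
by apply: eq_bigr => r _; rewrite linearZ mxE.
Qed.

Lemma map_mul_smx m n p (f : {scalar H}) (T : 'M[H]_(m, n)) (P : 'M[k]_(n, p)) :
  map_mx f (T *m smx P) = map_mx f T *m P.
Proof.
apply/matrixP => i j; rewrite mxE mul_smxE linear_sum mxE.
by apply: eq_bigr => r _; rewrite linearZ mxE mulrC.
Qed.

End ScalarMatrices.
Arguments smx {k H m n} P.

Section Corepresentations.
Variables (k : fieldType) (H : bialgType k).

(** The coefficient matrix of a comodule in a chosen basis; changes of basis and subcomodules become
    products with matrices over k. *)
Definition corep n (T : 'M[H]_n) : Prop :=
  map_mx counit T = 1%:M /\
  forall i j, comul (T i j) = \sum_r T i r \ox T r j.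

Lemma corep_counit n (T : 'M[H]_n) : corep T ->
  forall i j, counit (T i j) = (i == j)%:R.
Proof. by move=> [/matrixP eT _] i j; have := eT i j; rewrite !mxE. Qed.

Lemma comul_mxP n (T : 'M[H]_n) :
  (forall i j, comul (T i j) = \sum_r T i r \ox T r j) <->
  map_mx (@comul_ring k H) T = map_mx (@tens_inl k H) T *m map_mx (@tens_inr k H) T.
Proof.
split=> [dT|/matrixP dT i j].
  apply/matrixP => i j; rewrite !mxE; apply: etrans (dT i j) _.
  by apply: eq_bigr => r _; rewrite !mxE tens_inlr.
have := dT i j; rewrite !mxE => E; apply: etrans E _.
by apply: eq_bigr => r _; rewrite !mxE tens_inlr.
Qed.

Lemma map_smx_inl m n (P : 'M[k]_(m, n)) :
  map_mx (@tens_inl k H) (smx P) = map_mx (@comul_ring k H) (smx P).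
Proof.
apply/matrixP => i j; rewrite !mxE !linearZ /=; congr (_ *: _).
by rewrite !rmorph1.
Qed.

Lemma map_smx_inr m n (P : 'M[k]_(m, n)) :
  map_mx (@tens_inr k H) (smx P) = map_mx (@comul_ring k H) (smx P).
Proof.
apply/matrixP => i j; rewrite !mxE !linearZ /=; congr (_ *: _).
by rewrite !rmorph1.
Qed.

Lemma hitl_corep n (T : 'M[H]_n) (f : {scalar H}) : corep T ->
  map_mx (hitl f) T = smx (map_mx f T) *m T.
Proof.
move=> [_ dT]; apply/matrixP => i j; rewrite mxE smx_mulE (hitl_sum _ (dT i j)).
by apply: eq_bigr => r _; rewrite mxE.
Qed.

Lemma hitr_corep n (T : 'M[H]_n) (f : {scalar H}) : corep T ->
  map_mx (hitr f) T = T *m smx (map_mx f T).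
Proof.
move=> [_ dT]; apply/matrixP => i j; rewrite mxE mul_smxE (hitr_sum _ (dT i j)).
by apply: eq_bigr => r _; rewrite mxE.
Qed.

Lemma corep1 : corep (1%:M : 'M[H]_1).
Proof.
split=> [|i j]; last by rewrite !ord1 big_ord1 !mxE comul1.
by apply/matrixP => i j; rewrite !mxE !ord1 counit1.
Qed.

(* The last hypothesis says that the row space of [w] is a subcomodule. *)
Lemma sub_corep m n (T : 'M[H]_n) (w : 'M[k]_(m, n)) (w' : 'M[k]_(n, m)) :
  corep T -> w *m w' = 1%:M -> smx w *m T = smx w *m T *m smx w' *m smx w ->
  corep (smx w *m T *m smx w').
Proof.
move=> [eT /comul_mxP dT] ww' wT; split.
  by rewrite map_mul_smx map_smx_mul eT mulmx1.
apply: (proj2 (comul_mxP (smx w *m T *m smx w'))); rewrite !map_mxM dT !map_smx_inl !map_smx_inr.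
have := congr1 (map_mx (@tens_inl k H)) wT; rewrite !map_mxM !map_smx_inl => E.
by rewrite !mulmxA -E.
Qed.

Lemma conj_corep n (T : 'M[H]_n) (P Q : 'M[k]_n) :
  corep T -> P *m Q = 1%:M -> corep (smx P *m T *m smx Q).
Proof.
move=> cT PQ; apply: sub_corep => //.
by rewrite -[RHS]mulmxA -smxM (mulmx1C PQ) smx1 mulmx1.
Qed.

(** The matrix of H coacting on itself by Delta in the basis [tbase]; see [comul_tbase]. *)
Definition reg_corep : 'M[H]_(dim H) :=
  \matrix_(i, j) hitl (coordf i) (tbase j).

Lemma comul_tbase j : comul (tbase j) = \sum_i tbase i \ox reg_corep i j.
Proof. by rewrite comul_base; apply: eq_bigr => i _; rewrite mxE. Qed.

Lemma tbase_reg j : tbase j = \sum_i counit (tbase i : H) *: reg_corep i j.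
Proof. by rewrite -{1}(hitl_counit (tbase j)) (hitl_sum _ (comul_tbase j)). Qed.

Lemma reg_corepP : corep reg_corep.
Proof.
split=> [|l j].
  apply/matrixP => i j; rewrite !mxE.
  have := congr1 (coordf i) (hitr_counit (tbase j : H)).
  rewrite (hitr_sum _ (comul_tbase j)) linear_sum coordf_base => <-.
  rewrite (bigD1 i) //= [X in _ + X]big1 => [|a /negPf ai].
    by rewrite addr0 linearZ /= coordf_base eqxx mulr1 !mxE.
  by rewrite linearZ /= coordf_base eq_sym ai mulr0.
have := comulA (tbase j : H).
rewrite comul_tbase (linear_sum (tens_map comul idfun)).
rewrite (linear_sum (tens_map idfun comul)) (linear_sum (@tens_assoc _ _ _ _)).
(* [q] extracts the coefficient of [tbase l] in the first tensor factor; applied to coassociativity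
   at [tbase j], it leaves the required identity. *)
pose q : {linear tens H (tens H H) -> tens H H} :=
  tens_lift (fun (a : H) (b : tens H H) => coordf l a *: b).
have qE a b : q (a \ox b) = coordf l a *: b by apply: tens_hitlE.
have qS (F : 'I_(dim H) -> tens H H) : \sum_i q (tbase i \ox F i) = F l.
  rewrite (bigD1 l) //= [X in _ + X]big1 => [|a /negPf al]; rewrite qE coordf_base.
    by rewrite eqxx scale1r addr0.
  by rewrite eq_sym al scale0r.
move=> /(congr1 q); rewrite !(linear_sum q).
under [in X in _ = X -> _]eq_bigr => i _ do rewrite /= tens_mapE.
rewrite [X in _ = X -> _]qS => <-; apply: eq_bigr => i _.
rewrite /= tens_mapE /= comul_tbase tpure_suml (linear_sum (@tens_assoc _ _ _ _)).
rewrite (linear_sum q); under eq_bigr => a _ do rewrite /= tens_assocE.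
by rewrite qS.
Qed.

(** By [tbase_reg] the entries of the regular corepresentation span H. Linear identities can thus be
    checked on entries of corepresentations, where Delta is explicit. *)
Lemma corep_ext (W : vectType k) (F G : {linear H -> W}) :
  (forall n (T : 'M[H]_n) i j, corep T -> F (T i j) = G (T i j)) -> F =1 G.
Proof.
move=> FG x; rewrite (coordf_sum x) !linear_sum; apply: eq_bigr => j _.
rewrite !linearZ tbase_reg !linear_sum; congr (_ *: _); apply: eq_bigr => i _.
by rewrite !linearZ FG //; apply: reg_corepP.
Qed.

End Corepresentations.
Arguments reg_corep {k H}.

(** * Antipode, dual corepresentations and integrals *)

Section Antipode.
Variables (k : fieldType) (H : hopfAlgType k).
Implicit Types f g : {scalar H}.

Lemma corep_ext_fun (W : vectType k) (F G : H -> W) : linear F -> linear G ->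
  (forall n (T : 'M[H]_n) i j, corep T -> F (T i j) = G (T i j)) -> F =1 G.
Proof.
move=> lF lG.
pose mF := GRing.isLinear.Build k H W _ _ lF.
pose mG := GRing.isLinear.Build k H W _ _ lG.
pose F' : {linear H -> W} := HB.pack F mF.
pose G' : {linear H -> W} := HB.pack G mG.
exact: (corep_ext (F := F') (G := G')).
Qed.

Definition dual_corep n (T : 'M[H]_n) : 'M[H]_n := (map_mx antipode T)^T.

Lemma dual_corepE n (T : 'M[H]_n) i j : dual_corep T i j = antipode (T j i).
Proof. by rewrite !mxE. Qed.

Lemma corep_antipodel n (T : 'M[H]_n) : corep T -> map_mx antipode T *m T = 1%:M.
Proof.
move=> [/matrixP eT dT]; apply/matrixP => i j; rewrite !mxE.
have := antipodel (T i j); rewrite dT linear_sum /=.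
have := eT i j; rewrite !mxE => -> E; rewrite -[RHS]scaler_nat -E.
apply: eq_bigr => r _; rewrite mxE tens_liftE // => [v a x y|u a x y].
  by rewrite linearP mulrDl -scalerAl.
by rewrite mulrDr -scalerAr.
Qed.

Lemma corep_antipoder n (T : 'M[H]_n) : corep T -> T *m map_mx antipode T = 1%:M.
Proof.
move=> [/matrixP eT dT]; apply/matrixP => i j; rewrite !mxE.
have := antipoder (T i j); rewrite dT linear_sum /=.
have := eT i j; rewrite !mxE => -> E; rewrite -[RHS]scaler_nat -E.
apply: eq_bigr => r _; rewrite mxE tens_liftE // => [v a x y|u a x y].
  by rewrite mulrDl -scalerAl.
by rewrite linearP mulrDr -scalerAr.
Qed.

Lemma sum_corep_dual n (T : 'M[H]_n) i j : corep T ->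
  \sum_r T i r * dual_corep T j r = (i == j)%:R.
Proof.
move=> /corep_antipoder/matrixP/(_ i j); rewrite !mxE => <-.
by apply: eq_bigr => r _; rewrite !mxE.
Qed.

Lemma sum_dual_corep n (T : 'M[H]_n) i j : corep T ->
  \sum_r dual_corep T r i * T r j = (i == j)%:R.
Proof.
move=> /corep_antipodel/matrixP/(_ i j); rewrite !mxE => <-.
by apply: eq_bigr => r _; rewrite !mxE.
Qed.

(** Delta applied to S(T) is a left inverse of Delta(T), and [R S *m L S] is a right inverse of it,
    so the two agree: S reverses the comultiplication. The transposition in [dual_corep] restores
    the order. *)
Lemma dual_corepP n (T : 'M[H]_n) : corep T -> corep (dual_corep T).
Proof.
move=> cT; have [eT dT] := cT; split.
  apply/matrixP => i j; rewrite !mxE.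
  have := sum_dual_corep j i cT => /(congr1 counit).
  rewrite linear_sum /= (bigD1 i) //= [X in _ + X]big1 => [|r /negPf ri].
    rewrite counitM (corep_counit cT) eqxx mulr1 addr0 !mxE => ->.
    by rewrite eq_sym -[_%:R in LHS]scaler_nat linearZ /= counit1 mulr1.
  by rewrite counitM (corep_counit cT) ri mulr0.
pose D (A : 'M[H]_n) := map_mx (@comul_ring k H) A.
pose L (A : 'M[H]_n) := map_mx (@tens_inl k H) A.
pose R (A : 'M[H]_n) := map_mx (@tens_inr k H) A.
set S := map_mx antipode T.
have DT : D T = L T *m R T by apply/comul_mxP.
have SD : D S = R S *m L S.
  have E : D T *m (R S *m L S) = 1%:M.
    rewrite DT mulmxA -[L T *m _ *m _]mulmxA -map_mxM corep_antipoder //.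
    by rewrite map_mx1 mulmx1 -map_mxM corep_antipoder // map_mx1.
  rewrite -[LHS]mulmx1 -E mulmxA -map_mxM corep_antipodel //.
  by rewrite map_mx1 mul1mx.
move=> i j; have /matrixP/(_ j i) := SD; rewrite !mxE => E; apply: etrans E _.
by apply: eq_bigr => r _; rewrite !mxE tens_inrl.
Qed.

Lemma hitl_antipode f x :
  hitl f (antipode x) = antipode (hitr (f \o antipode) x).
Proof.
apply: (corep_ext (F := hitl f \o antipode)
  (G := antipode \o hitr (f \o antipode))) => n T i j cT /=.
rewrite (hitr_sum _ (cT.2 i j)) -dual_corepE.
rewrite (hitl_sum _ ((dual_corepP cT).2 j i)) linear_sum.
by apply: eq_bigr => r _; rewrite linearZ /= -!dual_corepE.
Qed.

Definition shiftf (f : H -> k) (x h : H) : k := f (x * h).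
Lemma shiftf_scalar f x : scalar (shiftf f x).
Proof. by move=> a y z; rewrite /shiftf mulrDr -scalerAr linearP. Qed.
HB.instance Definition _ f x :=
  GRing.isLinear.Build k H k _ (shiftf f x) (shiftf_scalar f x).

Lemma hitl_mul f x h (I : finType) (a b : I -> H) :
  comul x = \sum_i a i \ox b i ->
  hitl f (x * h) = \sum_i b i * hitl (shiftf f (a i)) h.
Proof.
move=> dx; rewrite /hitl comulM dx -[tens_mul _ _]/(tens_mull _ _).
rewrite (linear_sum (tens_mull (comul h))) linear_sum; apply: eq_bigr => i _ /=.
rewrite -/(hitl _ h) (hitl_sum _ (comul_base h)) /tens_mull (comul_base h).
rewrite (linear_sum (tens_mul (a i \ox b i))) linear_sum mulr_sumr.
apply: eq_bigr => j _; by rewrite /= tens_mulE tens_hitlE -scalerAr.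
Qed.

(** For x = [T j l] the right side is x_1 S(x_2) h_2 f(S(x_3) h_1), where x_1 S(x_2) cancels. For an
    integral f the right side is also x_1 f(S(x_2) h), which makes the functionals f(S(-) h) and
    f(S(x) -) tractable. *)
Lemma hitl_shift_dual n (T : 'M[H]_n) f l j h : corep T ->
  hitl (shiftf f (dual_corep T l j)) h
  = \sum_r T j r * hitl f (dual_corep T l r * h).
Proof.
move=> cT; have [_ dU] := dual_corepP cT.
under eq_bigr => r _ do rewrite (hitl_mul _ _ (dU l r)) mulr_sumr.
rewrite exchange_big /= (bigD1 j) //= [X in _ + X]big1 => [|q /negPf qj].
  under eq_bigr => r _ do rewrite mulrA.
  by rewrite -mulr_suml sum_corep_dual // eqxx mul1r addr0.
under eq_bigr => r _ do rewrite mulrA.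
by rewrite -mulr_suml sum_corep_dual // eq_sym qj mul0r.
Qed.

Lemma hitl_sumf (f : H -> k) (I : finType) (g : I -> H -> k) x :
  (forall y, f y = \sum_i g i y) -> hitl f x = \sum_i hitl (g i) x.
Proof.
move=> fg; rewrite /hitl /tens_lift [RHS]exchange_big; apply: eq_bigr => a _ /=.
rewrite [RHS]exchange_big; apply: eq_bigr => b _ /=.
by rewrite fg scaler_suml scaler_sumr.
Qed.

Lemma hitl_coordf i h :
  hitl (coordf i) h = \sum_j coordf j h *: (reg_corep i j : H).
Proof.
rewrite {1}(coordf_sum h) linear_sum; apply: eq_bigr => j _.
by rewrite linearZ mxE.
Qed.

(** Equivalently f * g = g(1) f for every functional g: a right integral in the dual algebra. *)
Definition is_integral f : Prop := forall h, hitl f h = f h *: 1.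

(* The coordinate functionals make up a colinear map from H to the regular
   corepresentation; contracting it with the double dual yields colinear maps
   to the trivial one. *)
Lemma integral_exists : exists2 f, is_integral f & exists h, f h != 0.
Proof.
pose T : 'M[H]_(dim H) := reg_corep; pose U := dual_corep T.
pose V := dual_corep U.
have cT : corep T := reg_corepP H.
have cU : corep U := dual_corepP cT; have cV : corep V := dual_corepP cU.
pose F l h := \sum_i coordf i (V l i * h).
have lF l : scalar (F l).
  move=> a x y; rewrite /F mulr_sumr -big_split; apply: eq_bigr => i _ /=.
  by rewrite mulrDr -scalerAr linearP.
pose mF l := GRing.isLinear.Build k H k _ _ (lF l).
pose G l : {scalar H} := HB.pack (F l) (mF l).
have [[l [h nz]]|Z] := pselect (exists l, exists h, F l h != 0).
  exists (G l) => [x|]; last by exists h.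
  rewrite (@hitl_sumf _ _ (fun i => shiftf (coordf i) (V l i))) //=.
  under eq_bigr => i _ do rewrite hitl_shift_dual //.
  under eq_bigr => i _ do under eq_bigr => r _ do rewrite hitl_coordf mulr_sumr.
  rewrite exchange_big /= /F scaler_suml; apply: eq_bigr => r _.
  rewrite exchange_big /= (bigD1 r) //= [X in _ + X]big1 => [|s /negPf sr].
    under eq_bigr => i _ do rewrite -scalerAr.
    by rewrite -scaler_sumr sum_dual_corep // eqxx addr0.
  under eq_bigr => i _ do rewrite -scalerAr.
  by rewrite -scaler_sumr sum_dual_corep // eq_sym sr scaler0.
(* If every [F l] vanished, then so would the sum over l of [F l (U l j)]. As V is the dual of U,
   that sum is [coordf j 1], and 1 would be 0. *)
suff H0 : (1 : H) = 0 by have := oner_neq0 H; rewrite H0 eqxx.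
apply: coordf_ext => j; rewrite linear0.
transitivity (\sum_l F l (U l j * 1)); last first.
  by rewrite big1 // => l _; apply/eqP/negPn/negP => nz; apply: Z; exists l, (U l j * 1).
rewrite /F exchange_big /= (bigD1 j) //= [X in _ + X]big1 => [|i /negPf ij].
  rewrite -linear_sum; under eq_bigr => l _ do rewrite mulrA.
  by rewrite -mulr_suml sum_dual_corep // eqxx mul1r addr0.
rewrite -linear_sum; under eq_bigr => l _ do rewrite mulrA.
by rewrite -mulr_suml sum_dual_corep // ij mul0r linear0.
Qed.

(** The elements satisfying the hypothesis on x form a space N stable under every [hitl g]. The
    counit vanishes on N: since S(y_2) S(S(y_1)) = counit(y) 1, the number counit(y) f(h0) is a sum
    of values f(S(y') h') with y' in N. Hence g(x), the counit of [hitl g x], is 0 for all g. *)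
Lemma integral_nondeg f x : is_integral f -> (exists h, f h != 0) ->
  (forall h, f (antipode x * h) = 0) -> x = 0.
Proof.
move=> intf [h0 nz].
pose m h := shiftf f^~ h \o antipode.
have lm h : scalar (m h).
  by move=> a y z; rewrite /m /= /shiftf linearP mulrDl -scalerAl linearP.
pose mm h := GRing.isLinear.Build k H k _ _ (lm h).
pose M h : {scalar H} := HB.pack (m h) (mm h).
(* This is y_1 f(S(y_2) h) = f(S(y) h_1) h_2, from [hitl_shift_dual] and the integral property. *)
have hitM h y : hitr (M h) y = hitl (shiftf f (antipode y)) h.
  apply: (@corep_ext_fun _ (hitr (M h)) (fun y => hitl (shiftf f (antipode y)) h))
    => [|a u v|n T i j cT]; first exact: hitr_linear.
    rewrite !(hitl_sum _ (comul_base h)) scaler_sumr -big_split.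
    apply: eq_bigr => i _ /=; rewrite scalerA -scalerDl; congr (_ *: _).
    by rewrite /shiftf linearP mulrDl -scalerAl linearP.
  rewrite (hitr_sum _ (cT.2 i j)) -dual_corepE hitl_shift_dual //.
  by apply: eq_bigr => r _; rewrite intf mulr_algr /= /m /= /shiftf dual_corepE.
pose N y := forall h, f (antipode y * h) = 0.
have N_hitl g y : N y -> N (hitl g y).
  move=> Ny h; rewrite -[LHS]/(M h (hitl g y)) hit_adj hitM.
  rewrite (hitl_sum _ (comul_base h)) big1 ?linear0 // => i _.
  by rewrite /= /shiftf Ny scale0r.
have SS (y : H) : \sum_i antipode (hitl (coordf i) y) * antipode (antipode (tbase i))
    = counit y *: 1.
  pose F (z : H) := \sum_i antipode (hitl (coordf i) z) * antipode (antipode (tbase i)).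
  apply: (@corep_ext_fun _ F (fun z => counit z *: (1 : H))) => [a u v|a u v|n T p q cT].
  - rewrite /F scaler_sumr -big_split; apply: eq_bigr => i _ /=.
    by rewrite !linearP mulrDl -scalerAl.
  - by rewrite linearP scalerDl scalerA.
  rewrite /F; under eq_bigr => i _ do
    rewrite (hitl_sum _ (cT.2 p q)) linear_sum mulr_suml.
  rewrite exchange_big /= (corep_counit cT).
  have cU := dual_corepP cT.
  transitivity (\sum_r dual_corep T q r * dual_corep (dual_corep T) p r).
    apply: eq_bigr => r _; rewrite !dual_corepE {2}(coordf_sum (T p r)).
    rewrite !linear_sum mulr_sumr; apply: eq_bigr => i _.
    by rewrite !linearZ /= -scalerAl -scalerAr.
  by rewrite sum_corep_dual // eq_sym scaler_nat.
have N_counit y : N y -> counit y = 0.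
  move=> Ny; apply/eqP; have /eqP: counit y * f h0 = 0.
    have := congr1 (fun z => f (z * h0)) (SS y).
    rewrite -scalerAl linearZ /= mul1r => <-.
    rewrite mulr_suml linear_sum big1 // => i _.
    by rewrite /= -mulrA; apply: N_hitl.
  by rewrite mulf_eq0 (negPf nz) orbF.
move=> Nx; apply: functional_ext => g; rewrite linear0.
by rewrite -{1}(hitr_counit x) -hit_adj; apply/N_counit/N_hitl.
Qed.

Lemma antipode_inj : injective (@antipode k H).
Proof.
have [f intf nz] := integral_exists => x y xy; apply/eqP; rewrite -subr_eq0.
apply/eqP/(integral_nondeg intf nz) => h.
by rewrite linearB /= xy subrr mul0r linear0.
Qed.

End Antipode.

(** * Injective linear maps and primitive elements *)

Section InjectiveLinear.
Variables (k : fieldType) (U W : vectType k) (f : {linear U -> W}).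
Hypothesis f_inj : injective f.

Lemma lker_inj : lker (linfun f) == 0%VS.
Proof. by apply/lker0P => x y; rewrite !lfunE; apply: f_inj. Qed.

Lemma linear_linv : exists g : {linear W -> U}, cancel f g.
Proof.
exists ((linfun f)^-1)%VF => x; rewrite -[f x](lfunE f).
by apply: (lker0_lfunK lker_inj).
Qed.

Lemma dim_limg_inj : \dim (limg (linfun f)) = dim U.
Proof. by rewrite limg_dim_eq ?dimvf // (eqP lker_inj) capv0. Qed.

Lemma dim_inj : (dim U <= \dim {:W})%N.
Proof. by rewrite -dim_limg_inj dimvS // subvf. Qed.

End InjectiveLinear.

Section Primitive.
Variables (k : fieldType) (H : bialgType k).
Hypothesis char0 : [pchar k] =i pred0.

Lemma natr_neq0 n : n.+1%:R != 0 :> k.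
Proof. by rewrite ((pcharf0P k).1 char0). Qed.

Variable x : H.
Hypothesis dx : comul x = x \ox 1 + 1 \ox x.

Lemma comul_primX n : comul (x ^+ n) =
  \sum_(i < n.+1) ('C(n, i)%:R *: x ^+ (n - i)) \ox x ^+ i.
Proof.
rewrite -[comul _]/(comul_ring (x ^+ n)) rmorphXn /= {1}/comul_ring dx.
rewrite -[_ + _]/(tens_inl x + tens_inr x).
have cx : GRing.comm (tens_inl x) (tens_inr x).
  by rewrite /GRing.comm tens_inlr tens_inrl.
rewrite exprDn_comm //; apply: eq_bigr => i _.
rewrite -!rmorphXn tens_inlr /tpure linearZ /= linearZ /= -scalemxAl.
by rewrite scaler_nat.
Qed.

Lemma counit_prim : counit x = 0.
Proof.
have := hitl_counit x; rewrite /hitl dx linearD /= !tens_hitlE counit1 scale1r.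
move=> /eqP; rewrite -subr_eq0 addrK => /eqP/(congr1 counit).
by rewrite linear0 linearZ /= counit1 mulr1.
Qed.

Definition powers n (c : 'rV[k]_n) : H := \sum_(i < n) c 0 i *: x ^+ i.
Lemma powers_linear n : linear (@powers n).
Proof.
move=> a c d; rewrite /powers scaler_sumr -big_split; apply: eq_bigr => i _ /=.
by rewrite !mxE scalerDl scalerA.
Qed.
HB.instance Definition _ n :=
  GRing.isLinear.Build k 'rV[k]_n H _ (@powers n) (@powers_linear n).

Lemma powers_delta n (i : 'I_n) : powers (delta_mx 0 i) = x ^+ i.
Proof.
rewrite /powers (bigD1 i) //= big1 ?addr0 => [|j /negPf ji].
  by rewrite mxE !eqxx scale1r.
by rewrite mxE ji andbF scale0r.
Qed.

Lemma powers_functional n : injective (@powers n) ->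
  forall i : 'I_n, exists f : {scalar H},
    forall j : 'I_n, f (x ^+ j) = (j == i :> nat)%:R.
Proof.
move=> /linear_linv[g gK] i.
have lf : scalar (fun y => g y 0 i) by move=> a y z; rewrite linearP !mxE.
pose mf := GRing.isLinear.Build k H k _ _ lf.
exists (HB.pack (fun y => g y 0 i) mf : {scalar H}) => j /=.
by rewrite -powers_delta gK mxE eqxx eq_sym.
Qed.

(** All powers of a nonzero primitive x would be independent, against finite dimension. In the
    induction, f and g are dual to x and x^(n+1) among 1, ..., x^(n+1). Applied to the two factors
    of Delta of a relation of degree n+2, they return n+2 times its leading coefficient, and n+2 is
    invertible in characteristic 0. *)
Lemma primitive_eq0 : x = 0.
Proof.
apply/eqP/negPn/negP => x0.
suff inj n : injective (@powers n.+2).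
  have /dim_inj := inj (\dim {:H}); rewrite /dim /= mul1n.
  by rewrite ltnNge leqnSn.
elim: n => [|n IH]; apply: raddf_inj => c c0; have {c0} : powers c = 0 by [].
  rewrite /powers big_ord_recl big_ord1 expr0 expr1 => c0.
  have c00 : c 0 ord0 = 0.
    move/(congr1 counit): c0; rewrite linearD !linearZ /= counit1 counit_prim.
    by rewrite mulr1 mulr0 addr0 linear0.
  move: c0; rewrite c00 scale0r add0r => /eqP.
  rewrite scaler_eq0 (negPf x0) orbF => /eqP c1.
  by apply/rowP => i; rewrite mxE; case: (unliftP ord0 i) => [j|] ->; rewrite ?[j]ord1.
rewrite /powers big_ord_recr /= => c0.
have [f fE] := powers_functional IH (lift ord0 ord0).
have [g gE] := powers_functional IH ord_max.
have fgE i : (i < n.+3)%N ->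
    g (hitl f (x ^+ i)) = (i == n.+2)%:R * n.+2%:R.
  rewrite ltnS => lei; rewrite (hitl_sum _ (comul_primX i)) linear_sum /=.
  (* The values of f and g at x^(n+2) are unknown, but each occurs only multiplied by the value of
     the other at 1, which is 0. *)
  have gf0 j : (j <= i)%N -> (j != n.+1)%N || (i != n.+2) ->
      f (x ^+ (i - j)) * g (x ^+ j) = 0.
    move=> leji neq; case: (ltnP j n.+2) => [ltj|gej]; last first.
      have /eqP-> : (i - j == 0)%N by rewrite subn_eq0 (leq_trans lei).
      by have := fE ord0; rewrite /= expr0 => ->; rewrite mul0r.
    have := gE (Ordinal ltj); rewrite /= => ->.
    case: eqP neq => [->|_ _] /=; last by rewrite mulr0.
    move=> neq; have lti : (i < n.+2)%N by rewrite ltn_neqAle neq.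
    have lt2 : (i - n.+1 < n.+2)%N by rewrite (leq_ltn_trans (leq_subr _ _)).
    have := fE (Ordinal lt2); rewrite /= => ->.
    have /eqP-> : (i - n.+1 == 0)%N by rewrite subn_eq0.
    by rewrite mul0r.
  have [ei|ni] := eqVneq i n.+2; last first.
    rewrite mul0r big1 // => j _; rewrite !linearZ /= -mulrA gf0 ?mulr0 //.
      by rewrite -ltnS.
    by rewrite ni orbT.
  subst i; rewrite mul1r.
  have lt1 : (n.+1 < n.+3)%N by [].
  rewrite (bigD1 (Ordinal lt1)) //= big1 => [|j neq].
    rewrite addr0 !linearZ /= binSn subSnn.
    have := fE (lift ord0 ord0); rewrite /= /bump /= addn0 => ->.
    by have := gE ord_max; rewrite /= => ->; rewrite eqxx !mulr1.
  rewrite !linearZ /= -mulrA gf0 ?mulr0 //; first by rewrite -ltnS.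
  by apply/orP; left.
have cn : c 0 ord_max = 0.
  have := congr1 (g \o hitl f) c0; rewrite /= linear0 linearD linear_sum /=.
  rewrite linearD linear_sum big1 /= ?add0r => [|i _]; last first.
    have lti := ltn_ord i; rewrite !linearZ /= fgE; last exact: ltnW.
    by rewrite (ltn_eqF lti) mul0r mulr0.
  rewrite linear0 !linearZ /= fgE // eqxx mul1r => /eqP.
  by rewrite mulf_eq0 (negPf (natr_neq0 _)) orbF => /eqP.
move: c0; rewrite cn scale0r addr0 => c0.
have c1 : \row_(i < n.+2) c 0 (widen_ord (leqnSn _) i) = 0.
  apply: IH; by rewrite linear0 -[RHS]c0; apply: eq_bigr => i _; rewrite mxE.
apply/rowP => i; rewrite [RHS]mxE; case: (unliftP ord_max i) => [j|] -> //.
have /rowP/(_ j) := c1; rewrite !mxE => <-; congr (c 0 _).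
by apply: val_inj; rewrite /= /bump leqNgt ltn_ord.
Qed.

End Primitive.

(** * Burnside's theorem on transitive matrix algebras *)

Section Burnside.
Variables (k : closedFieldType) (n N : nat) (g : 'I_N -> 'M[k]_n).

Definition in_lin_span (A : 'M[k]_n) := exists c, A = \sum_i c i *: g i.

Lemma in_lin_spanP a A B :
  in_lin_span A -> in_lin_span B -> in_lin_span (a *: A + B).
Proof.
move=> [c ->] [d ->]; exists (fun i => a * c i + d i).
rewrite scaler_sumr -big_split; apply: eq_bigr => i _ /=.
by rewrite scalerDl scalerA.
Qed.

Hypothesis n_gt0 : (0 < n)%N.
Hypothesis spanM : forall A B, in_lin_span A -> in_lin_span B ->
  in_lin_span (A *m B).
Hypothesis trans : forall v w : 'rV_n, v != 0 ->
  exists2 A, in_lin_span A & v *m A = w.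

(** Take A nonzero of minimal rank, A = C w. If the rank exceeds 1, choose x, y for which x A and y
    A are two rows of w, and B in the span with x A B = y. For an eigenvalue mu of the compression M
    = w B C, the element A B A - mu A = C (M - mu) w has smaller rank, yet it sends x to y A - mu x
    A, which is nonzero. *)
Lemma rank1_in_span : exists c : 'cV_n, exists w : 'rV_n,
  [/\ c != 0, w != 0 & in_lin_span (c *m w)].
Proof.
pose P r := `[< exists A, [/\ in_lin_span A, A != 0 & \rank A = r] >].
have exP : exists r, P r.
  have d0 : delta_mx 0 (Ordinal n_gt0) != 0 :> 'rV[k]_n.
    apply/eqP => /matrixP/(_ 0 (Ordinal n_gt0)); rewrite !mxE !eqxx; apply/eqP.
    exact: oner_neq0.
  have [A sA dA] := trans (delta_mx 0 (Ordinal n_gt0)) d0.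
  exists (\rank A); apply/asboolP; exists A; split=> //.
  by apply: contra_eq_neq dA => ->; rewrite mulmx0 eq_sym.
case: (ex_minnP exP) => r /asboolP[A [sA A0 rA]] minr.
suff r1 : r = 1%N.
  move: (col_base A) (row_base A) (mulmx_base A); rewrite rA r1 => c w E.
  exists c, w; split; last by rewrite E.
    by apply: contraNneq A0 => c0; rewrite -E c0 mul0mx.
  by apply: contraNneq A0 => w0; rewrite -E w0 mulmx0.
case: r rA minr => [/eqP|[//|r]] rA minr; first by rewrite mxrank_eq0 (negPf A0) in rA.
pose C := col_base A; pose w := row_base A.
have wA : (w <= A)%MS by rewrite eq_row_base.
have wfree : row_free w by apply: row_base_free.
have Aw : C *m w = A by apply: mulmx_base.
have r0 : (0 < \rank A)%N by rewrite rA.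
have r1 : (1 < \rank A)%N by rewrite rA.
pose i0 := Ordinal r0; pose i1 := Ordinal r1.
have [x xE] := submxP (submx_trans (row_sub i0 w) wA).
have [y yE] := submxP (submx_trans (row_sub i1 w) wA).
have wdelta d : d != 0 -> d *m w != 0.
  by apply: contra_neq => dw; apply: (row_free_inj wfree); rewrite dw mul0mx.
have delta_neq0 i (a : 'rV[k]_(\rank A)) : a 0 i = 1 -> a != 0.
  by move=> ai; apply/eqP => a0; move/eqP: ai; rewrite a0 mxE eq_sym oner_eq0.
have x0 : x *m A != 0.
  rewrite -xE rowE; apply: wdelta; apply: (delta_neq0 i0).
  by rewrite mxE !eqxx.
have [B sB xB] := trans y x0.
pose M := w *m B *m C.
have wBA : w *m (B *m A) = M *m w by rewrite /M -mulmxA Aw mulmxA.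
have [mu /eigenvalueP[u uM u0]] : exists mu, eigenvalue M mu.
  have [|mu rmu] := elimT (@closed_rootP k (char_poly M)).
    by rewrite size_char_poly eqSS -lt0n.
  by exists mu; rewrite eigenvalue_root_char.
pose A' := A *m B *m A - mu *: A.
have A'E : A' = C *m (M - mu%:M) *m w.
  rewrite /A' mulmxBr mulmxBl mul_mx_scalar -scalemxAl Aw -[C *m M *m w]mulmxA.
  by rewrite -wBA [C *m _]mulmxA Aw !mulmxA.
have sA' : in_lin_span A'.
  rewrite /A' addrC -scaleNr; apply: in_lin_spanP => //.
  by apply: (spanM (spanM sA sB) sA).
have xA' : x *m A' != 0.
  rewrite /A' mulmxBr -scalemxAr !mulmxA xB -xE -yE !rowE scalemxAl -mulmxBl.
  apply: wdelta; apply: (delta_neq0 i1).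
  by rewrite !mxE !eqxx /= mulr0 subr0.
have : P (\rank A').
  apply/asboolP; exists A'; split=> //.
  by apply: contra_neq xA' => ->; rewrite mulmx0.
move/minr; rewrite leqNgt => /negP[]; rewrite -rA A'E.
apply: leq_ltn_trans (mxrankM_maxl _ _) _.
apply: leq_ltn_trans (mxrankM_maxr _ _) _.
rewrite ltn_neqAle rank_leq_row andbT; apply: contra_neqN u0 => fr.
by apply: (row_free_inj fr); rewrite mul0mx mulmxBr mul_mx_scalar uM subrr.
Qed.

(** Let c w be the rank one element. Transitivity replaces w by any row. It also makes the columns
    [g a *m c] span everything: a nonzero row z annihilating them all could be moved to a coordinate
    at which c is nonzero. So all rank one matrices lie in the span. *)
Theorem burnside A : in_lin_span A.
Proof.
have [c [w [c0 w0 scw]]] := rank1_in_span.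
have row_span v : in_lin_span (c *m v).
  by have [B sB <-] := trans v w0; rewrite mulmxA; apply: spanM.
pose K := \matrix_(a < N) (g a *m c)^T.
have Kfull : row_full K.
  rewrite -col_leq_rank; apply: contraT; rewrite -ltnNge => ltK.
  have : cokermx K != 0 by rewrite -mxrank_eq0 mxrank_coker subn_eq0 -ltnNge.
  case/matrix0Pn => i [j nz]; pose z := (col j (cokermx K))^T.
  have z0 : z != 0 by apply: contraNneq nz => /rowP/(_ i); rewrite !mxE => ->.
  have Kz : K *m z^T = 0 by rewrite trmxK colE mulmxA mulmx_coker mul0mx.
  have [i' [j' ci]] := matrix0Pn _ c0.
  have [B [d ->] zB] := trans (delta_mx 0 i') z0.
  have : z *m (\sum_a d a *: g a) *m c = 0.
    rewrite mulmx_sumr mulmx_suml big1 // => a _.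
    rewrite -scalemxAr -scalemxAl -mulmxA; apply/eqP; rewrite scaler_eq0.
    apply/orP; right; apply/eqP/trmx_inj; rewrite trmx_mul trmx0.
    have /(congr1 (row a)) := Kz; rewrite row_mul rowK row0 => E.
    by rewrite -[RHS]E.
  rewrite zB -rowE => /rowP/(_ j'); rewrite !mxE => E.
  by rewrite E eqxx in ci.
have mul_span (c' : 'cV_n) v : in_lin_span (c' *m v).
  have /submxP[d dE] : (c'^T <= K)%MS by apply: submx_full.
  have -> : c' = (\sum_a d 0 a *: g a) *m c.
    apply: trmx_inj; rewrite dE; apply/rowP => i.
    rewrite [RHS]mxE mulmx_suml summxE mxE.
    by apply: eq_bigr => a _; rewrite -scalemxAl [in LHS]mxE [in RHS]mxE [in LHS]mxE.
  by rewrite -mulmxA; apply: spanM; [exists (fun a => d 0 a) | ].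
have sum_span (I : finType) (F : I -> 'M[k]_n) :
    (forall i, in_lin_span (F i)) -> in_lin_span (\sum_i F i).
  move=> sF; elim/big_ind: _ => // [|X Y sX sY].
    by exists (fun=> 0); rewrite big1 // => i _; rewrite scale0r.
  by rewrite -[X]scale1r; apply: in_lin_spanP.
have -> : A = \sum_i delta_mx i 0 *m row i A.
  apply/matrixP => i j; rewrite summxE (bigD1 i) //= big1 ?addr0 => [|a /negPf ai].
    by rewrite mxE big_ord1 !mxE !eqxx mul1r.
  by rewrite mxE big_ord1 !mxE eq_sym ai mul0r.
by apply: sum_span => i; apply: mul_span.
Qed.

End Burnside.

(** * Irreducible corepresentations and composition series *)

Section Irreducible.
Variables (k : fieldType) (H : bialgType k).
Implicit Types f : {scalar H}.

Lemma mx_coordf_ext m n (A B : 'M[H]_(m, n)) :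
  (forall a, map_mx (coordf a) A = map_mx (coordf a) B) -> A = B.
Proof.
move=> AB; apply/matrixP => i j; apply: coordf_ext => a.
by have /matrixP/(_ i j) := AB a; rewrite !mxE.
Qed.

Lemma map_mx_coordf m n (A : 'M[H]_(m, n)) f :
  map_mx f A = \sum_a f (tbase a) *: map_mx (coordf a) A.
Proof.
apply/matrixP => i j; rewrite mxE summxE {1}(coordf_sum (A i j)) linear_sum.
by apply: eq_bigr => a _; rewrite linearZ !mxE mulrC.
Qed.

(** A comodule is a module over the dual algebra; f acts by [map_mx f T]. *)
Lemma map_mx_conv n (T : 'M[H]_n) f (g : {scalar H}) : corep T ->
  map_mx (g \o hitl f) T = map_mx f T *m map_mx g T.
Proof. by move=> cT; rewrite map_mx_comp hitl_corep // map_smx_mul. Qed.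

Definition lincomb n (T : 'M[H]_n) (c : 'M[k]_n) : H :=
  \sum_i \sum_j c i j *: T i j.
Lemma lincomb_linear n (T : 'M[H]_n) : linear (lincomb T).
Proof.
move=> a c d; rewrite /lincomb scaler_sumr -big_split; apply: eq_bigr => i _ /=.
rewrite scaler_sumr -big_split; apply: eq_bigr => j _ /=.
by rewrite !mxE scalerDl scalerA.
Qed.
HB.instance Definition _ n (T : 'M[H]_n) :=
  GRing.isLinear.Build k 'M[k]_n H _ (lincomb T) (lincomb_linear T).

Lemma lincomb_delta n (T : 'M[H]_n) i j : lincomb T (delta_mx i j) = T i j.
Proof.
rewrite /lincomb (bigD1 i) //= [X in _ + X]big1 => [|a /negPf ai].
  rewrite (bigD1 j) //= big1 => [|b /negPf bj].
    by rewrite mxE !eqxx scale1r !addr0.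
  by rewrite mxE bj andbF scale0r.
by rewrite big1 // => b _; rewrite mxE ai scale0r.
Qed.

Lemma map_lincomb n (T : 'M[H]_n) c f :
  f (lincomb T c) = \sum_i \sum_j c i j * (map_mx f T) i j.
Proof.
rewrite linear_sum; apply: eq_bigr => i _; rewrite linear_sum.
by apply: eq_bigr => j _; rewrite linearZ mxE.
Qed.

(* For a corepresentation over an algebraically closed field this is
   irreducibility, by Burnside's theorem. *)
Definition indep n (T : 'M[H]_n) : Prop := injective (lincomb T).

Lemma indep_functional n (T : 'M[H]_n) : indep T ->
  forall a b, exists f, map_mx f T = delta_mx a b.
Proof.
move=> /linear_linv[g gK] a b.
have lf : scalar (fun y => g y a b) by move=> u y z; rewrite linearP !mxE.
pose mf := GRing.isLinear.Build k H k _ _ lf.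
exists (HB.pack (fun y => g y a b) mf : {scalar H}); apply/matrixP => i j.
by rewrite mxE /= -lincomb_delta gK !mxE eq_sym [b == j]eq_sym.
Qed.

Lemma indep_neq0 n (T : 'M[H]_n) i j : indep T -> T i j != 0.
Proof.
move=> iT; apply/eqP => Tij.
have : delta_mx i j = 0 :> 'M[k]_n by apply: iT; rewrite lincomb_delta linear0.
by move=> /matrixP/(_ i j); rewrite !mxE !eqxx; apply/eqP/oner_neq0.
Qed.

Lemma corep_map_counit n (T : 'M[H]_n) : corep T -> map_mx counit T = 1%:M.
Proof. by case. Qed.

End Irreducible.

Section CorepInduction.
Variables (k : closedFieldType) (H : bialgType k).
Implicit Types f : {scalar H}.

(** Without a proper stable subspace the matrices [map_mx f T] form a transitive algebra, hence by
    Burnside include all matrix units. Evaluating these on a relation among the entries of T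
    isolates each of its coefficients, so T would be independent. *)
Lemma stable_row_space n (T : 'M[H]_n) : corep T -> (0 < n)%N -> ~ indep T ->
  exists m (w : 'M[k]_(m, n)), [/\ (0 < m < n)%N, row_free w
    & forall f, (w *m map_mx f T <= w)%MS].
Proof.
move=> cT n0 niT; apply: contrapT => noW; apply: niT.
pose g a := map_mx (coordf a) T.
have span_f f : in_lin_span g (map_mx f T).
  by exists (fun a => f (tbase a)); rewrite map_mx_coordf.
have span0 : in_lin_span g 0.
  by exists (fun=> 0); rewrite big1 // => i _; rewrite scale0r.
have spanM A B : in_lin_span g A -> in_lin_span g B -> in_lin_span g (A *m B).
  move=> [c ->] [d ->]; rewrite mulmx_suml; elim/big_ind: _ => // [X Y sX sY|a _].
    by rewrite -[X]scale1r; apply: in_lin_spanP.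
  rewrite mulmx_sumr; elim/big_ind: _ => // [X Y sX sY|b _].
    by rewrite -[X]scale1r; apply: in_lin_spanP.
  rewrite -scalemxAl -scalemxAr -map_mx_conv // scalerA -[_ *: _]addr0.
  by apply: in_lin_spanP => //; apply: span_f.
have trans (v w : 'rV_n) : v != 0 -> exists2 A, in_lin_span g A & v *m A = w.
  move=> v0; pose V := \matrix_a (v *m g a).
  have vV f : (v *m map_mx f T <= V)%MS.
    rewrite map_mx_coordf mulmx_sumr summx_sub // => a _.
    by rewrite -scalemxAr scalemx_sub // -[v *m _](rowK (fun a => v *m g a)) row_sub.
  have Vst f : (row_base V *m map_mx f T <= row_base V)%MS.
    rewrite eq_row_base (eqmxMr _ (eq_row_base V)); apply/row_subP => a.
    rewrite row_mul rowK -mulmxA -map_mx_conv //; apply: vV.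
  have V0 : (0 < \rank V)%N.
    rewrite lt0n mxrank_eq0; apply: contraNneq v0 => V0.
    have := vV counit; rewrite corep_map_counit // mulmx1 V0 => /submxP[d ->].
    by rewrite mulmx0.
  have [Vfull|] := boolP (row_full V).
    have /submxP[d ->] : (w <= V)%MS by apply: submx_full.
    exists (\sum_a d 0 a *: g a); first by exists (fun a => d 0 a).
    rewrite mulmx_sumr [RHS]mulmx_sum_row; apply: eq_bigr => a _.
    by rewrite rowK -scalemxAr.
  rewrite -col_leq_rank -ltnNge => Vn; case: noW.
  by exists (\rank V), (row_base V); rewrite V0 Vn row_base_free.
have all_span := burnside n0 spanM trans.
apply: raddf_inj => c c0; apply/matrixP => i j; rewrite mxE.
have [d dE] := all_span (delta_mx i j).
have : \sum_a d a * coordf a (lincomb T c) = 0.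
  by rewrite big1 // => a _; rewrite [lincomb T c]c0 linear0 mulr0.
under eq_bigr => a _ do rewrite map_lincomb mulr_sumr.
rewrite exchange_big /=.
under eq_bigr => i' _ do under eq_bigr => a _ do rewrite mulr_sumr.
under eq_bigr => i' _ do rewrite exchange_big /=.
have E i' j' : \sum_a d a * (c i' j' * (map_mx (coordf a) T) i' j')
    = c i' j' * (delta_mx i j : 'M[k]_n) i' j'.
  rewrite dE summxE mulr_sumr; apply: eq_bigr => a _.
  by rewrite [in RHS]mxE mulrCA.
under eq_bigr => i' _ do under eq_bigr => j' _ do rewrite E.
rewrite (bigD1 i) //= [X in _ + X]big1 => [|i' /negPf ii']; last first.
  by rewrite big1 // => j' _; rewrite mxE ii' mulr0.
rewrite (bigD1 j) //= big1 => [|j' /negPf jj']; last first.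
  by rewrite mxE jj' andbF mulr0.
by rewrite mxE !eqxx mulr1 !addr0.
Qed.

Lemma intertwine_pinv m n (T : 'M[H]_n) (w : 'M[k]_(m, n)) w' :
  w *m w' = 1%:M -> (forall f, (w *m map_mx f T <= w)%MS) ->
  smx w *m T = smx w *m T *m smx w' *m smx w.
Proof.
move=> ww' wT; apply: mx_coordf_ext => a.
rewrite !map_mul_smx !map_smx_mul; have /submxP[d ->] := wT (coordf a).
by rewrite -[d *m w *m _]mulmxA ww' mulmx1.
Qed.

(** Descent on n: a proper stable subspace carries a smaller corepresentation. The rows of w span an
    irreducible subcomodule, and w' recovers coordinates on it. *)
Lemma irr_sub n (T : 'M[H]_n) : corep T -> (0 < n)%N ->
  exists m (w : 'M[k]_(m, n)) w', [/\ (0 < m)%N, w *m w' = 1%:M,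
    indep (smx w *m T *m smx w')
    & smx w *m T = smx w *m T *m smx w' *m smx w].
Proof.
elim/ltn_ind: n T => n IH T cT n0.
have [iT|niT] := pselect (indep T).
  by exists n, 1%:M, 1%:M; rewrite smx1 !mulmx1 !mul1mx; split.
have [m [w [/andP[m0 mn] wfree wT]]] := stable_row_space cT n0 niT.
have [w' ww'] := row_freeP wfree.
have wTE := intertwine_pinv ww' wT.
have cT' := sub_corep cT ww' wTE.
have [p [v [v' [p0 vv' iT' vT]]]] := IH m mn _ cT' m0.
exists p, (v *m w), (w' *m v'); split=> //.
- by rewrite mulmxA -[v *m w *m _]mulmxA ww' mulmx1.
- by move: iT'; rewrite !smxM !mulmxA.
by rewrite !smxM -[LHS]mulmxA wTE [LHS]mulmxA vT !mulmxA.
Qed.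

(** Gaussian elimination writes w as an invertible matrix times the first m rows of [row_ebase w];
    its remaining rows complete the basis. *)
Lemma row_free_complete m p (w : 'M[k]_(m, m + p)) : row_free w ->
  exists v : 'M[k]_(p, m + p), col_mx w v \in unitmx.
Proof.
move=> wfree; exists (row_mx 0 1%:M *m row_ebase w).
have -> : col_mx w (row_mx 0 1%:M *m row_ebase w)
    = block_mx (col_ebase w) 0 0 1%:M *m row_ebase w.
  rewrite /block_mx mul_col_mx; congr col_mx.
  rewrite -{1}(mulmx_ebase w) (eqP wfree); congr (_ *m _).
  by rewrite pid_mx_row mul_mx_row mulmx1 mulmx0.
rewrite unitmx_mul row_ebase_unit andbT unitmxE det_lblock det1 mulr1 -unitmxE.
exact: col_ebase_unit.
Qed.

Lemma block_corepr m n (T1 : 'M[H]_m) (X : 'M[H]_(n, m)) (T2 : 'M[H]_n) :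
  corep (block_mx T1 0 X T2) -> corep T2.
Proof.
move=> [eT dT]; split.
  move: eT; rewrite map_block_mx -[1%:M]/(scalar_mx 1).
  by rewrite scalar_mx_block => /eq_block_mx[].
move=> i j; have := dT (rshift m i) (rshift m j).
rewrite block_mxEdr big_split_ord /= big1 ?add0r => [->|r _].
  by apply: eq_bigr => r _; rewrite !block_mxEdr.
by rewrite block_mxEur [X in _ \ox X]mxE tpure0r.
Qed.

(** Induction along a composition series: a basis of an irreducible subcomodule, completed to the
    whole space, makes the matrix block triangular, and the quotient [T2] is smaller. *)
Lemma corep_ind (Q : forall n, 'M[H]_n -> Prop) :
  (forall T : 'M[H]_0, Q 0 T) ->
  (forall n (T : 'M[H]_n) (P P' : 'M[k]_n), corep T -> P *m P' = 1%:M ->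
     Q n (smx P *m T *m smx P') -> Q n T) ->
  (forall m n (T1 : 'M[H]_m) (X : 'M[H]_(n, m)) (T2 : 'M[H]_n), (0 < m)%N ->
     corep T1 -> indep T1 -> corep T2 -> corep (block_mx T1 0 X T2) ->
     Q n T2 -> Q (m + n)%N (block_mx T1 0 X T2)) ->
  forall n (T : 'M[H]_n), corep T -> Q n T.
Proof.
move=> Q0 Qconj Qblock n; elim/ltn_ind: n => n IH T cT.
case: (posnP n) => [n0|n0]; first by move: T cT IH; rewrite n0.
have [m [w [w' [m0 ww' iT1 wT]]]] := irr_sub cT n0.
have wfree : row_free w by apply/row_freeP; exists w'.
have [p np] : exists p, n = (m + p)%N.
  exists (n - m)%N; rewrite subnKC //; have := rank_leq_col w.
  by rewrite (eqP wfree).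
subst n; have [v Pu] := row_free_complete wfree.
set P := col_mx w v in Pu; have PP' := mulmxV Pu.
apply: (Qconj _ _ _ _ cT PP').
have cT' := conj_corep cT PP'; set T1 := smx w *m T *m smx w' in iT1.
have [X [T2 TE]] : exists X, exists T2,
    smx P *m T *m smx (invmx P) = block_mx T1 0 X T2.
  pose Z := smx v *m T *m smx (invmx P).
  exists (lsubmx Z), (rsubmx Z); rewrite /block_mx hsubmxK.
  have smxP : smx P = col_mx (smx w) (smx v) :> 'M[H]_(m + p, m + p) by apply: map_col_mx.
  rewrite smxP !mul_col_mx; congr col_mx.
  rewrite wT -/T1 -mulmxA -smxM.
  have -> : w *m invmx P = row_mx 1%:M 0.
    have := PP'; rewrite {1}/P mul_col_mx -[1%:M]/(scalar_mx 1) scalar_mx_block.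
    by move=> /eq_col_mx[].
  by rewrite -[smx _]/(map_mx _ _) map_row_mx -/(smx _) smx1 -/(smx _) smx0 mul_mx_row mulmx1 mulmx0.
move: cT'; rewrite TE => cT'; apply: Qblock => //.
- exact: sub_corep.
- by apply: block_corepr cT'.
apply: IH; first by rewrite -{1}[p]add0n ltn_add2r.
by apply: block_corepr cT'.
Qed.

End CorepInduction.

(** * Coefficient coalgebras and their simplicity *)

Definition pack_scalar (k : fieldType) (U : vectType k) (F : U -> k)
    (lF : scalar F) : {scalar U} :=
  HB.pack F (GRing.isLinear.Build k U k _ _ lF).

Lemma sep_functional (k : fieldType) (U : vectType k) (V : {vspace U}) x :
  x \notin V -> exists f : {scalar U}, f x = 1 /\ {in V, forall v, f v = 0}.
Proof.
move=> xV; pose y := x - projv V x.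
have y0 : v2r y != 0.
  apply: contraNneq xV => y0; suff -> : x = projv V x by apply: memv_proj.
  by apply/eqP; rewrite -subr_eq0; apply/eqP/v2r_inj; rewrite linear0.
have [i [j yj]] := matrix0Pn _ y0.
have lF : scalar (fun z => v2r ((\1 - projv V)%VF z) i j / v2r y i j).
  by move=> a u v; rewrite !linearP !mxE mulrDl mulrA.
exists (pack_scalar lF); split=> [|v vV] /=; rewrite add_lfunE opp_lfunE id_lfunE.
  by rewrite divff.
by rewrite projv_id // subrr linear0 mxE mul0r.
Qed.

Section Coefficients.
Variables (k : fieldType) (H : bialgType k).
Implicit Types (f g : {scalar H}) (D : {vspace H}).

Lemma subcoalg_hitl D f x : is_subcoalg D -> x \in D -> hitl f x \in D.
Proof.
move=> /is_subcoalgP cD /cD/tensvP[s dx]; rewrite /hitl dx.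
pose i : {linear subvs_of D -> H} := vsval.
rewrite (tens_lift_map i i) => [|v c y z|u c y z].
- apply: memv_suml => a _; apply: memv_suml => b _.
  by rewrite !memvZ // subvsP.
- by rewrite linearP /= scalerDl scalerA.
- by rewrite scalerDr !scalerA mulrC.
Qed.

Lemma subcoalg_hitr D f x : is_subcoalg D -> x \in D -> hitr f x \in D.
Proof.
move=> /is_subcoalgP cD /cD/tensvP[s dx]; rewrite /hitr dx.
pose i : {linear subvs_of D -> H} := vsval.
rewrite (tens_lift_map i i) => [|v c y z|u c y z].
- apply: memv_suml => a _; apply: memv_suml => b _.
  by rewrite !memvZ // subvsP.
- by rewrite scalerDr !scalerA mulrC.
- by rewrite linearP /= scalerDl scalerA.
Qed.

(** With the next two lemmas, H is a bimodule over its dual algebra, on the right through [hitl] and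
    on the left through [hitr]. *)
Lemma hitl_comp f g x : hitl (g \o hitl f) x = hitl g (hitl f x).
Proof.
apply: (corep_ext (F := hitl (g \o hitl f)) (G := hitl g \o hitl f)).
move=> n T i j cT /=; rewrite !(hitl_sum _ (cT.2 i j)) linear_sum /=.
under [RHS]eq_bigr => r _ do
  rewrite linearZ /= (hitl_sum _ (cT.2 r j)) scaler_sumr.
rewrite exchange_big; apply: eq_bigr => s _ /=.
rewrite (hitl_sum _ (cT.2 i s)) linear_sum scaler_suml.
by apply: eq_bigr => r _; rewrite linearZ scalerA.
Qed.

Lemma hitr_comp f g x : hitr (g \o hitl f) x = hitr f (hitr g x).
Proof.
apply: (corep_ext (F := hitr (g \o hitl f)) (G := hitr f \o hitr g)).
move=> n T i j cT /=; rewrite !(hitr_sum _ (cT.2 i j)) linear_sum /=.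
under [RHS]eq_bigr => r _ do
  rewrite linearZ /= (hitr_sum _ (cT.2 i r)) scaler_sumr.
rewrite exchange_big; apply: eq_bigr => s _ /=.
rewrite (hitl_sum _ (cT.2 s j)) linear_sum scaler_suml.
by apply: eq_bigr => r _; rewrite linearZ scalerA mulrC.
Qed.

Lemma hitlr f g x : hitl g (hitr f x) = hitr f (hitl g x).
Proof.
apply: (corep_ext (F := hitl g \o hitr f) (G := hitr f \o hitl g)).
move=> n T i j cT /=; rewrite (hitr_sum _ (cT.2 i j)) (hitl_sum _ (cT.2 i j)).
rewrite !linear_sum.
under eq_bigr => r _ do rewrite linearZ /= (hitl_sum _ (cT.2 i r)) scaler_sumr.
rewrite exchange_big; apply: eq_bigr => s _ /=.
rewrite linearZ /= (hitr_sum _ (cT.2 s j)) scaler_sumr.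
by apply: eq_bigr => r _; rewrite !scalerA mulrC.
Qed.

Lemma hitl1 f : hitl f 1 = f 1 *: 1.
Proof. by rewrite /hitl comul1 tens_hitlE. Qed.

Variables (n : nat) (T : 'M[H]_n).
Hypothesis cT : corep T.

Lemma hitl_lincomb f c : hitl f (lincomb T c) = lincomb T ((map_mx f T)^T *m c).
Proof.
rewrite linear_sum /=; under eq_bigr => i _ do rewrite linear_sum /=.
under eq_bigr => i _ do under eq_bigr => j _ do
  rewrite linearZ /= (hitl_sum _ (cT.2 i j)) scaler_sumr.
under eq_bigr => i _ do rewrite exchange_big /=.
rewrite exchange_big; apply: eq_bigr => r _ /=.
rewrite exchange_big; apply: eq_bigr => j _ /=.
rewrite mxE scaler_suml; apply: eq_bigr => i _.
by rewrite !mxE scalerA mulrC.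
Qed.

Lemma hitr_lincomb f c : hitr f (lincomb T c) = lincomb T (c *m (map_mx f T)^T).
Proof.
rewrite linear_sum /=; apply: eq_bigr => i _; rewrite linear_sum /=.
under eq_bigr => j _ do rewrite linearZ /= (hitr_sum _ (cT.2 i j)) scaler_sumr.
rewrite exchange_big; apply: eq_bigr => r _ /=.
rewrite mxE scaler_suml; apply: eq_bigr => j _.
by rewrite !mxE scalerA.
Qed.

Definition coef : {vspace H} := limg (linfun (lincomb T)).

Lemma coefP x : reflect (exists c, x = lincomb T c) (x \in coef).
Proof.
apply: (iffP memv_imgP) => [[c _ ->]|[c ->]]; exists c; rewrite ?memvf //.
  by rewrite lfunE.
by rewrite lfunE.
Qed.

Lemma mem_coef i j : T i j \in coef.
Proof. by apply/coefP; exists (delta_mx i j); rewrite lincomb_delta. Qed.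

Lemma coef_subcoalg : is_subcoalg coef.
Proof.
apply/is_subcoalgP => _ /coefP[c ->]; rewrite linear_sum memv_suml // => i _.
rewrite linear_sum memv_suml // => j _; rewrite linearZ memvZ //= cT.2.
by rewrite memv_suml // => r _; rewrite tpure_tensv // mem_coef.
Qed.

Lemma coef_sub D : (forall i j, T i j \in D) -> (coef <= D)%VS.
Proof.
move=> TD; apply/subvP => _ /coefP[c ->].
by rewrite memv_suml // => i _; rewrite memv_suml // => j _; rewrite memvZ.
Qed.

Hypothesis iT : indep T.

(** The simplicity of a matrix algebra, dualized: functionals dual to entries of T, acting from both
    sides, replace c by E_aq c E_sb = c_qs E_ab, with c_qs a nonzero entry. *)
Lemma indep_subcoalg D c : is_subcoalg D -> c != 0 -> lincomb T c \in D ->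
  (coef <= D)%VS.
Proof.
move=> sD c0 cD; apply: coef_sub => a b; have [q [s cqs]] := matrix0Pn _ c0.
have [f fT] := indep_functional iT q a.
have := subcoalg_hitl f sD cD; rewrite hitl_lincomb fT => fD.
have [g gT] := indep_functional iT b s.
have := subcoalg_hitr g sD fD; rewrite hitr_lincomb gT.
rewrite !trmx_delta.
have -> : delta_mx a q *m c *m delta_mx s b = c q s *: delta_mx a b.
  apply/matrixP => i j; rewrite mxE (bigD1 s) //= [X in _ + X]big1 => [|t /negPf ts].
    rewrite addr0 mxE (bigD1 q) //= [X in _ + X]big1 => [|t /negPf tq].
      by rewrite !mxE !eqxx andbT addr0 /= -mulnb natrM mulrA [c q s * _]mulrC.
    by rewrite mxE tq andbF mul0r.
  by rewrite [delta_mx s b t j]mxE ts mulr0.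
rewrite linearZ /= lincomb_delta => /(memvZ (c q s)^-1).
by rewrite scalerA mulVf // scale1r.
Qed.

Lemma coef_simple : (0 < n)%N -> simple_subcoalg coef.
Proof.
move=> n0; split; first exact: coef_subcoalg.
  apply: contraTneq (mem_coef (Ordinal n0) (Ordinal n0)) => ->.
  by rewrite memv0 indep_neq0.
move=> D sD Dc; case: (eqVneq D 0%VS) => [|D0]; [by left | right].
apply/eqP; rewrite eqEsubv Dc /=.
have pD := memv_pick D; have /coefP[c cE] := subvP Dc _ pD.
rewrite cE in pD; apply: indep_subcoalg pD => //.
by apply: contra_neq D0 => c0; apply/eqP; rewrite -vpick0 cE c0 linear0.
Qed.

Lemma coef_coradical : (0 < n)%N -> (coef <= coradical_space H)%VS.
Proof. by move=> n0; apply: (coradical_spaceP H).1; apply: coef_simple. Qed.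

Lemma dim_coef : \dim coef = (n * n)%N.
Proof. exact: dim_limg_inj. Qed.

End Coefficients.

Lemma mem1_coradical (k : fieldType) (H : bialgType k) : 1 \in coradical_space H.
Proof.
have i1 : indep (1%:M : 'M[H]_1).
  apply: raddf_inj => c c0; have {c0} : lincomb (1%:M : 'M[H]_1) c = 0 by [].
  rewrite /lincomb !big_ord1 mxE => /eqP.
  rewrite scaler_eq0 oner_eq0 orbF => /eqP c0.
  by apply/matrixP => i j; rewrite !ord1 c0 mxE.
have := mem_coef (1%:M : 'M[H]_1) 0 0; rewrite mxE.
by apply: subvP; apply: coef_coradical => //; apply: corep1.
Qed.

(** * Coinvariant vectors and splitting off matrix blocks *)

Section FixedVector.
Variables (k : fieldType) (H : bialgType k) (n : nat) (T : 'M[H]_n).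
Hypothesis iT : indep T.

(** If T c = c then c_j (T c)_i - c_i (T c)_j = 0, a linear relation among entries of T. Its
    coefficient c_j c_l at [T i l], with i different from j, vanishes; take l = j. *)
Lemma indep_fixed (c : 'I_n -> k) : (1 < n)%N ->
  (forall i, \sum_j c j *: T i j = c i *: 1) -> forall i, c i = 0.
Proof.
move=> n1 fix_c.
have cc i j l : i != j -> c j * c l = 0.
  move=> ij; pose d := \matrix_(a, b) (c b * ((a == i)%:R * c j - (a == j)%:R * c i)).
  have dE : lincomb T d = 0.
    have ji : (j == i) = false by rewrite eq_sym (negPf ij).
    rewrite /lincomb (bigD1 i) //= [X in _ + X](bigD1 j) ?ji //=.
    rewrite [X in _ + (_ + X)]big1 => [|a /andP[/negPf ai /negPf aj]]; last first.
      by rewrite big1 // => b _; rewrite mxE ai aj !mul0r subrr mulr0 scale0r.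
    rewrite addr0.
    under eq_bigr => b _ do
      rewrite mxE eqxx (negPf ij) mul1r mul0r subr0 mulrC -scalerA.
    rewrite -scaler_sumr fix_c.
    under eq_bigr => b _ do
      rewrite mxE eqxx ji mul1r mul0r sub0r mulrC -scalerA.
    by rewrite -scaler_sumr fix_c !scalerA mulNr scaleNr mulrC subrr.
  have /matrixP/(_ i l) : d = 0 by apply: iT; rewrite dE linear0.
  by rewrite !mxE eqxx (negPf ij) mul1r mul0r subr0 mulrC.
move=> j; have [i ij] : exists i : 'I_n, i != j.
  have n0 : (0 < n)%N by apply: leq_trans n1.
  have [->|j0] := eqVneq j (Ordinal n0); first by exists (Ordinal n1).
  by exists (Ordinal n0); rewrite eq_sym.
by have /eqP := cc _ _ j ij; rewrite mulf_eq0 orbb => /eqP.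
Qed.

End FixedVector.

Section CentralIdempotents.
Variables (k : fieldType) (H : bialgType k).
Implicit Types f g : {scalar H}.
Local Notation H0 := (coradical_space H).

(* In terms of the dual algebra H^*, acting on H on both sides: f is a central
   idempotent, it acts as 1 on the unit of H, and the block of H cut out by
   1 - f is contained in the coradical. *)
Definition central_idem f : Prop :=
  [/\ forall x, hitl f x = hitr f x, forall x, f (hitl f x) = f x, f 1 = 1
    & forall x, x - hitl f x \in H0].

(** The convolution f * g of commuting idempotents; the last condition is 1 - f g = (1 - f) + f (1 -
    g). *)
Lemma central_idem_comp f g :
  central_idem f -> central_idem g -> central_idem (g \o hitl f).
Proof.
move=> [cf idf f1 df] [cg idg g1 dg].
have fg x : hitl g (hitl f x) = hitl f (hitl g x).
  by rewrite cf hitlr -cf.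
split=> [x|x||x].
- by rewrite hitl_comp hitr_comp -cg -cf fg.
- rewrite /= hitl_comp -fg idg -hitl_comp; congr (g _).
  rewrite !(hitl_sum _ (comul_base x)); apply: eq_bigr => i _.
  by rewrite /= idf.
- by rewrite /= hitl1 f1 scale1r.
rewrite hitl_comp -[x - _](subrKA (hitl f x)).
by apply: memvD; [apply: df | apply: dg].
Qed.

End CentralIdempotents.

Section Blocks.
Variables (k : fieldType) (H : hopfAlgType k).
Implicit Types f g : {scalar H}.
Local Notation H0 := (coradical_space H).

Section Units.
Variables (n : nat) (T : 'M[H]_n).
Hypotheses (cT : corep T) (iT : indep T).
Hypothesis codim : (\dim {:H} - \dim H0 < n * n)%N.
Variable lam : {scalar H}.
Hypotheses (lam_int : is_integral lam) (lam_neq0 : exists h, lam h != 0).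

(* Otherwise the n^2 functionals lam (antipode (T i j) * -), which are linearly
   independent, would all factor through H / H0. *)
Lemma integral_coradical : exists i j x,
  x \in H0 /\ lam (antipode (T i j) * x) != 0.
Proof.
apply: contrapT => Z.
have vanish i j x : x \in H0 -> lam (antipode (T i j) * x) = 0.
  by move=> xH; apply/eqP/negPn/negP => nz; apply: Z; exists i, j, x.
pose X x : 'M[k]_n := \matrix_(i, j) lam (antipode (T i j) * x).
have lX : linear X.
  move=> a x y; apply/matrixP => i j.
  by rewrite !mxE mulrDr -scalerAr linearP.
pose mX := GRing.isLinear.Build k H 'M[k]_n _ _ lX.
pose X' : {linear H -> 'M[k]_n} := HB.pack X mX.
(* A functional with matrix c that vanishes on the image of [X'] makes lam degenerate at
   [lincomb T c], so c = 0 and [X'] is onto. Its kernel contains the coradical, against [codim]. *)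
have full : limg (linfun X') = fullv.
  apply/eqP; rewrite eqEsubv subvf; apply/subvP => A _.
  apply: contraT => /sep_functional[f [fA f0]].
  pose c := \matrix_(i, j) f (delta_mx i j).
  have fE B : f B = \sum_i \sum_j B i j * c i j.
    rewrite {1}(matrix_sum_delta B) linear_sum; apply: eq_bigr => i _.
    by rewrite linear_sum; apply: eq_bigr => j _; rewrite linearZ mxE.
  have c0 : c = 0.
    apply: iT; rewrite linear0; apply: (integral_nondeg lam_int lam_neq0) => h.
    rewrite [lincomb T c]/lincomb linear_sum mulr_suml linear_sum /=.
    rewrite -[RHS](f0 (X h)); last first.
      by rewrite -[X h]/(X' h) -[X' h](lfunE X') memv_img // memvf.
    rewrite fE; apply: eq_bigr => i _.
    rewrite linear_sum mulr_suml linear_sum; apply: eq_bigr => j _ /=.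
    by rewrite linearZ /= -scalerAl linearZ [X h i j]mxE mulrC.
  move: fA; rewrite fE c0 => /eqP.
  rewrite big1 => [|i _]; first by rewrite eq_sym oner_eq0.
  by rewrite big1 // => j _; rewrite mxE mulr0.
have H0ker : (H0 <= lker (linfun X'))%VS.
  apply/subvP => x xH; rewrite memv_ker lfunE /=; apply/eqP/matrixP => i j.
  by rewrite !mxE vanish.
have := limg_ker_dim (linfun X') fullv; rewrite full capfv.
have -> : \dim {:'M[k]_n} = (n * n)%N by rewrite dimvf.
move=> E; move: codim; rewrite -E ltnNge => /negP[].
by rewrite leq_subRL ?leq_add2r ?dimvS // E dimvS // subvf.
Qed.

(* The functionals psi r below form a colinear map from H to the comodule of T
   which does not vanish on the coradical; it therefore splits the inclusion of
   that comodule, and translating it by H^* yields matrix units. *)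
Lemma left_units : exists e : 'I_n -> 'I_n -> {scalar H},
  (forall a r, map_mx (e a r) T = delta_mx a r) /\
  (forall a r x, hitl (e a r) x = \sum_s e a s x *: T r s).
Proof.
have [i [j [x [xH nz]]]] := integral_coradical.
pose psi r : {scalar H} := shiftf lam (antipode (T r j)).
have hpsi r h : hitl (psi r) h = \sum_s psi s h *: T r s.
  rewrite /psi -dual_corepE hitl_shift_dual //; apply: eq_bigr => s _.
  by rewrite lam_int mulr_algr /= /shiftf dual_corepE.
(* Some simple summand S of the coradical contains u with [psi i u] nonzero. Then [hitl (psi i) u]
   lies in S and is a nonzero combination of row i of T, so S is [coef T]. *)
have [p pi] : exists p, exists q, psi i (T p q) != 0.
  apply: contrapT => Z; have psiT y : y \in coef T -> psi i y = 0.
    move=> /coefP[c ->]; rewrite map_lincomb big1 // => a _.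
    rewrite big1 // => b _; apply/eqP; rewrite mulf_eq0 orbC.
    by rewrite mxE; apply/orP; left; apply/negPn/negP => ne; apply: Z; exists a, b.
  have [_ [s simp_s H0E]] := coradical_spaceP H.
  move: nz; rewrite -[lam _]/(psi i x) => /eqP[].
  move: xH; rewrite H0E; elim: s simp_s {H0E} x => [|S s IH] simp_s x.
    by rewrite big_nil memv0 => /eqP->; rewrite linear0.
  rewrite big_cons => /memv_addP[u uS [v vs ->]]; rewrite linearD.
  rewrite (IH _ v vs) ?addr0; last by move=> D Ds; apply: simp_s; rewrite inE Ds orbT.
  have [sS S0 minS] := simp_s S (mem_head _ _).
  apply/eqP/negPn/negP => nzu.
  pose c := \matrix_(a, b) ((a == i)%:R * psi b u).
  have cE : lincomb T c = hitl (psi i) u.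
    rewrite hpsi /lincomb (bigD1 i) //= [X in _ + X]big1 => [|a /negPf ai].
      by rewrite addr0; apply: eq_bigr => b _; rewrite mxE eqxx mul1r.
    by rewrite big1 // => b _; rewrite mxE ai mul0r scale0r.
  have c0 : c != 0.
    apply: contra_neq nzu => /matrixP/(_ i i).
    by rewrite !mxE eqxx mul1r.
  have cS : lincomb T c \in S by rewrite cE subcoalg_hitl.
  have TS := indep_subcoalg cT iT sS c0 cS.
  case: (minS _ (coef_subcoalg cT) TS) => [C0|CS].
    have := mem_coef T i i; rewrite C0 memv0 => /eqP E.
    by have := indep_neq0 i i iT; rewrite E eqxx.
  by rewrite (psiT u) ?eqxx // ?CS in nzu.
case: pi => q nzq.
(* Schur's lemma: [hitl (psi r) (T u v)] is computed from Delta and from [hpsi], and the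
   coefficients at [T a b] are compared. *)
have psiE r u a b v :
    psi r (T u a) * (b == v)%:R = (a == r)%:R * psi b (T u v).
  have [f fT] := indep_functional iT a b.
  have fE c d : f (T c d) = ((c == a) && (d == b))%:R.
    by have /matrixP/(_ c d) := fT; rewrite !mxE.
  transitivity (f (hitl (psi r) (T u v))).
    rewrite (hitl_sum _ (cT.2 u v)) linear_sum (bigD1 a) //= big1 => [|c /negPf ca].
      by rewrite linearZ /= fE eqxx addr0 eq_sym.
    by rewrite linearZ /= fE ca mulr0.
  rewrite hpsi linear_sum (bigD1 b) //= big1 => [|c /negPf cb].
    by rewrite linearZ /= fE eqxx addr0 eq_sym andbT mulrC.
  by rewrite linearZ /= fE cb andbF mulr0.
set c := psi i (T p q) in nzq.
have psiT r a : psi r (T p a) = (a == r)%:R * c.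
  have E := psiE r p a r r; rewrite eqxx mulr1 in E; rewrite E.
  have := psiE i p q r r; rewrite eqxx mulr1 -/c => E'.
  have qi : q == i by apply: contraNT nzq => /negPf qi; rewrite E' qi mul0r.
  by rewrite E' qi mul1r.
(* The unit [e a r] is the convolution of [tau a] with [psi r], divided by c: [tau a] leads from row
   a to row p, where psi is known. *)
have [tau tauT] := choice (fun a => indep_functional iT a p).
have le a r : scalar (fun x => c^-1 * psi r (hitl (tau a) x)).
  by move=> u x' y'; rewrite !linearP mulrDr mulrCA.
exists (fun a r => pack_scalar (le a r)); split=> [a r|a r y].
  apply/matrixP => u v; rewrite mxE /=.
  have /matrixP/(_ u v) := hitl_corep (tau a) cT; rewrite mxE => ->.
  rewrite tauT smx_mulE linear_sum (bigD1 p) //= big1 => [|w /negPf wp].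
    rewrite addr0 linearZ /= psiT !mxE eqxx andbT -mulnb natrM.
    by rewrite [c^-1 * _]mulrC [_ * (_ * c)]mulrA mulfK.
  by rewrite mxE wp andbF scale0r linear0.
rewrite (hitl_sum _ (comul_base y)) /=.
under eq_bigr => s _ do rewrite -scalerA.
rewrite -scaler_sumr -[X in _ *: X](hitl_sum (psi r \o hitl (tau a)) (comul_base y)).
rewrite hitl_comp hpsi scaler_sumr; apply: eq_bigr => s _.
by rewrite scalerA.
Qed.

End Units.

Lemma indep_dual n (T : 'M[H]_n) : indep T -> indep (dual_corep T).
Proof.
move=> iT; set U := dual_corep T.
apply: raddf_inj => c c0; have {c0} : lincomb U c = 0 by [].
have -> : lincomb U c = antipode (lincomb T c^T).
  rewrite /lincomb exchange_big linear_sum; apply: eq_bigr => j _.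
  rewrite linear_sum; apply: eq_bigr => i _.
  by rewrite linearZ /= -dual_corepE [c^T _ _]mxE.
rewrite -(linear0 antipode) => /antipode_inj E.
by apply: trmx_inj; apply: iT; rewrite E trmx0 linear0.
Qed.

(** T and its dual yield units spanning a right and a left ideal of the dual algebra. They agree,
    because e_ps = e_ps * e'_ss = e'_ps, so the ideal is two-sided with central unit the sum of the
    e_pp, and f is the complementary idempotent. *)
Lemma block_functional n (T : 'M[H]_n) : (1 < n)%N -> corep T -> indep T ->
  (\dim {:H} - \dim H0 < n * n)%N ->
  exists2 f, central_idem f & map_mx f T = 0.
Proof.
move=> n1 cT iT codim; have [lam lam_int lam_nz] := integral_exists H.
have [e [eT eh]] := left_units cT iT codim lam_int lam_nz.
pose U := dual_corep T; have cU : corep U := dual_corepP cT.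
have iU : indep U := indep_dual iT.
have [e0 [e0U e0h]] := left_units cU iU codim lam_int lam_nz.
have [e' [e'T e'h]] : exists e' : 'I_n -> 'I_n -> {scalar H},
    (forall r p, map_mx (e' r p) T = delta_mx r p) /\
    (forall r p x, hitr (e' r p) x = \sum_s e' s p x *: T s r).
  (* Pulling the units of the dual back along the injective antipode exchanges the two actions. *)
  exists (fun r p => e0 p r \o antipode); split=> [r p|r p x].
    apply/matrixP => u v; have /matrixP/(_ v u) := e0U p r.
    by rewrite !mxE andbC.
  apply: antipode_inj; rewrite -hitl_antipode e0h linear_sum.
  by apply: eq_bigr => s _; rewrite linearZ /= -dual_corepE.
have ee' p s x : e p s x = e' p s x.
  have := hit_adj (e p s) (e' s s) x; rewrite eh e'h !linear_sum.
  rewrite (bigD1 s) //= big1 => [|u /negPf us]; last first.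
    have /matrixP/(_ s u) := e'T s s; rewrite !mxE us andbF => E.
    by rewrite linearZ /= E mulr0.
  rewrite (bigD1 p) //= big1 => [|u /negPf up]; last first.
    have /matrixP/(_ u s) := eT p s; rewrite !mxE up => E.
    by rewrite linearZ /= E mulr0.
  have /matrixP/(_ s s) := e'T s s; have /matrixP/(_ p s) := eT p s.
  by rewrite !mxE !eqxx !addr0 !linearZ /= => -> ->; rewrite !mulr1.
have lF : scalar (fun x => counit x - \sum_p e p p x).
  move=> a x y; rewrite linearP.
  under eq_bigr => p _ do rewrite linearP.
  by rewrite big_split /= -mulr_sumr opprD addrACA mulrBr.
pose f := pack_scalar lF.
have fl x : hitl f x = x - \sum_p \sum_s e p s x *: T p s.
  rewrite (hitl_sum _ (comul_base x)) /=.
  under eq_bigr => i _ do rewrite scalerBl scaler_suml.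
  rewrite sumrB -(hitl_sum counit (comul_base x)) hitl_counit exchange_big /=.
  congr (_ - _); apply: eq_bigr => p _.
  by rewrite -(hitl_sum (e p p) (comul_base x)) eh.
have fr x : hitr f x = x - \sum_p \sum_s e p s x *: T p s.
  rewrite (hitr_sum _ (comul_base x)) /=.
  under eq_bigr => i _ do rewrite scalerBl scaler_suml.
  rewrite sumrB -(hitr_sum counit (comul_base x)) hitr_counit exchange_big /=.
  congr (_ - _); rewrite [RHS]exchange_big /=; apply: eq_bigr => p _.
  under eq_bigr => i _ do rewrite ee'.
  rewrite -(hitr_sum (e' p p) (comul_base x)) e'h.
  by apply: eq_bigr => s _; rewrite ee'.
have fT : map_mx f T = 0.
  apply/matrixP => i j; rewrite !mxE /= (corep_counit cT).
  rewrite (bigD1 i) //= big1 => [|p /negPf pi].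
    have /matrixP/(_ i j) := eT i i; rewrite !mxE eqxx addr0 => ->.
    by rewrite eq_sym subrr.
  have /matrixP/(_ i j) := eT p p; rewrite !mxE => ->.
  by rewrite eq_sym pi.
(* The values [e p s 1], for fixed p, form a coinvariant vector of T; this is where n > 1 gives
   [f 1 = 1]. *)
have e1 p s : e p s 1 = 0.
  apply: (indep_fixed iT (c := fun s => e p s 1)) => // r.
  by rewrite -eh hitl1.
exists f => //; split=> [x|x||x].
- by rewrite fl fr.
- rewrite fl linearB linear_sum big1 ?subr0 // => p _.
  rewrite linear_sum big1 // => s _; rewrite linearZ /=.
  by have /matrixP/(_ p s) := fT; rewrite !mxE /= => ->; rewrite mulr0.
- by rewrite /= counit1 big1 ?subr0.
rewrite fl opprB addrC subrK.
apply: (subvP (coef_coradical cT iT (ltnW n1))).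
rewrite memv_suml // => p _; rewrite memv_suml // => s _.
by rewrite memvZ // mem_coef.
Qed.

End Blocks.

(** * The part of H over the unit *)

Section TrivialIsotype.
Variables (k : fieldType) (H : bialgType k).
Implicit Types f : {scalar H}.
Local Notation H0 := (coradical_space H).

(** Every column of [map_mx f T] is a coinvariant vector of T, hence zero when n > 1. *)
Lemma indep_trivial n (T : 'M[H]_n) f : (0 < n)%N -> corep T -> indep T ->
  (forall x, x \in H0 -> hitr f x = f x *: 1) ->
  map_mx f T = 0 \/ n = 1%N /\ T = 1%:M.
Proof.
move=> n0 cT iT fH0; have [|nz] := eqVneq (map_mx f T) 0; [by left | right].
have [i [j fij]] := matrix0Pn _ nz.
have fixj a : \sum_b f (T b j) *: T a b = f (T a j) *: 1.
  rewrite -(hitr_sum _ (cT.2 a j)); apply: fH0.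
  by apply: (subvP (coef_coradical cT iT n0)); apply: mem_coef.
case: (ltngtP n 1) => [n1|n1|n1]; first by move: n1; rewrite ltnNge n0.
  by have := indep_fixed iT n1 fixj i; move: fij; rewrite mxE => /eqP.
split=> //; move: T i j fij fixj {n0 cT iT nz}; rewrite n1 => T i j fij fixj.
apply/matrixP => a b; rewrite !ord1 mxE; have := fixj 0; rewrite big_ord1 !ord1.
move: fij; rewrite !ord1 mxE => nzf /(congr1 (fun x => (f (T 0 0))^-1 *: x)).
by rewrite !scalerA mulVf // !scale1r.
Qed.

End TrivialIsotype.

Section BlockTriangular.
Variables (k : fieldType) (H : bialgType k) (m n : nat).
Variables (T1 : 'M[H]_m) (X : 'M[H]_(n, m)) (T2 : 'M[H]_n).
Hypothesis cT : corep (block_mx T1 0 X T2).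

Lemma comul_block i j : comul (X i j) =
  \sum_r X i r \ox T1 r j + \sum_r T2 i r \ox X r j.
Proof.
have := cT.2 (rshift m i) (lshift n j); rewrite block_mxEdl => ->.
rewrite big_split_ord /=; congr (_ + _); apply: eq_bigr => r _.
  by rewrite block_mxEdl block_mxEul.
by rewrite block_mxEdr block_mxEdl.
Qed.

End BlockTriangular.

Section CoradicalFull.
Variables (k : closedFieldType) (H : bialgType k).
Hypothesis char0 : [pchar k] =i pred0.
Implicit Types f : {scalar H}.
Local Notation H0 := (coradical_space H).

Lemma trivial_extension n (X : 'M[H]_(n, 1)) :
  (forall i, comul (X i 0) = X i 0 \ox 1 + 1 \ox X i 0) -> X = 0.
Proof.
move=> dX; apply/matrixP => i j; rewrite ord1 mxE.
exact: (primitive_eq0 char0 (dX i)).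
Qed.

(** By [triv], f cuts a trivial comodule out of every comodule: it acts nontrivially only on trivial
    constituents, and trivial extensions split for lack of primitive elements. So [hitl f x] is in k
    1, while x - [hitl f x] is in the coradical. *)
Theorem coradical_full f : central_idem f ->
  (forall x, x \in H0 -> hitr f x = f x *: 1) -> H0 = fullv.
Proof.
move=> [cf idf f1 df] fH0.
have fcomm n (T : 'M[H]_n) : corep T -> smx (map_mx f T) *m T = T *m smx (map_mx f T).
  move=> cT; rewrite -hitl_corep // -hitr_corep //.
  by apply/matrixP => i j; rewrite !mxE cf.
have fidem n (T : 'M[H]_n) : corep T -> map_mx f T *m map_mx f T = map_mx f T.
  by move=> cT; rewrite -map_mx_conv //; apply/matrixP => i j; rewrite !mxE /= idf.
have triv n (T : 'M[H]_n) : corep T -> smx (map_mx f T) *m T = smx (map_mx f T).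
  move: n T; apply: corep_ind => [T|n T P P' cT PP' E|m n T1 X T2 m0 cT1 iT1 cT2 cT E].
  - by apply/matrixP => -[].
  - have K : smx P' *m smx P = 1%:M :> 'M[H]_n by rewrite -smxM (mulmx1C PP') smx1.
    move: E; rewrite map_mul_smx map_smx_mul; set F := map_mx f T.
    move=> /(congr1 (fun A => smx P' *m A *m smx P)).
    rewrite !smxM !mulmxA K !mul1mx -[smx F *m smx P' *m smx P]mulmxA K mulmx1.
    by rewrite -[_ *m smx P' *m smx P]mulmxA K mulmx1.
  have fT : map_mx f (block_mx T1 0 X T2)
      = block_mx (map_mx f T1) 0 (map_mx f X) (map_mx f T2).
    rewrite map_block_mx; congr block_mx.
    by apply/matrixP => i j; rewrite !mxE linear0.
  have comm := fcomm _ _ cT; have idem := fidem _ _ cT.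
  rewrite fT -[smx _]/(map_mx _ _) map_block_mx -!/(smx _) smx0 in comm *.
  rewrite fT !mulmx_block !(mulmx0, mul0mx, addr0, add0r) in idem.
  rewrite !mulmx_block !(mulmx0, mul0mx, addr0, add0r) in comm *.
  have [E11 _ Edl _] := eq_block_mx comm.
  have [_ _ Fdl _] := eq_block_mx idem.
  have [T10|[m1 T11]] := indep_trivial m0 cT1 iT1 fH0.
    (* Centrality turns the lower left block into T2 f(X). Idempotency gives f(X) = f(T2) f(X), so
       this is f(T2) T2 f(X) = f(X) by induction. *)
    rewrite E T10 smx0 mul0mx; congr block_mx.
    rewrite Edl T10 smx0 mulmx0 add0r; rewrite T10 mulmx0 add0r in Fdl.
    by rewrite -Fdl smxM mulmxA -fcomm // E.
  move: T1 X m0 cT1 iT1 cT comm idem fT T11 E11 Edl Fdl.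
  rewrite m1 => T1 X m0 cT1 iT1 cT comm idem fT T11 E11 Edl Fdl.
  have fT1 : map_mx f T1 = 1%:M.
    by apply/matrixP => i j; rewrite T11 !mxE; case: eqP; rewrite ?f1 ?linear0.
  rewrite E fT1 T11 smx1 mulmx1; congr block_mx; rewrite mulmx1.
  (* The column f(T2) X has primitive entries because f(T2) T2 = f(T2). *)
  rewrite -[RHS]addr0; congr (_ + _); apply: trivial_extension => i.
  have fXE : (smx (map_mx f T2) *m X) i 0 = \sum_r f (T2 i r) *: X r 0.
    by rewrite smx_mulE; apply: eq_bigr => r _; rewrite mxE.
  have dX r : comul (X r 0) = X r 0 \ox 1 + \sum_s T2 r s \ox X s 0.
    by rewrite (comul_block cT) big_ord1 T11 mxE.
  rewrite fXE linear_sum; under eq_bigr => r _ do rewrite linearZ /= dX scalerDr.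
  rewrite big_split /= tpure_suml; congr (_ + _).
    by apply: eq_bigr => r _; rewrite /tpure linearZ /= linearZ /= -scalemxAl.
  under eq_bigr => r _ do rewrite scaler_sumr.
  rewrite exchange_big tpure_sumr; apply: eq_bigr => s _ /=.
  have /matrixP/(_ i s) := E; rewrite smx_mulE mxE => Es.
  have -> : \sum_r f (T2 i r) *: (T2 r s \ox X s 0)
      = (\sum_r map_mx f T2 i r *: T2 r s) \ox X s 0.
    rewrite tpure_suml; apply: eq_bigr => r _.
    by rewrite mxE /tpure linearZ /= linearZ /= -scalemxAl.
  by rewrite Es mxE /tpure !linearZ /= -scalemxAl.
apply/eqP; rewrite eqEsubv subvf; apply/subvP => x _.
rewrite (coordf_sum x) memv_suml // => j _; rewrite memvZ // tbase_reg.
rewrite memv_suml // => i _; rewrite memvZ //.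
rewrite -[reg_corep i j](subrK (hitl f (reg_corep i j))) memvD ?df //.
have /matrixP/(_ i j) := hitl_corep f (reg_corepP H); rewrite mxE => ->.
by rewrite triv ?mxE ?memvZ ?mem1_coradical //; apply: reg_corepP.
Qed.

End CoradicalFull.

(** * Coalgebra morphisms, grouplike elements and models of the coradical *)

Section CoalgebraMorphisms.
Variable k : fieldType.

Definition comorph (C D : coalgType k) (f : C -> D) : Prop :=
  (forall x, comul (f x) = tens_map f f (comul x)) /\
  forall x, counit (f x) = counit x.

Lemma comorph_comp (C D E : coalgType k) (f : {linear D -> E}) (g : {linear C -> D}) :
  comorph f -> comorph g -> comorph (f \o g).
Proof.
move=> [df ef] [dg eg]; split=> x /=; last by rewrite ef eg.
by rewrite df dg tens_map_comp.
Qed.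

Lemma coalg_inl_comorph (C D : coalgType k) : comorph (@coalg_inl k C D).
Proof.
split=> x; first by rewrite {1}/comul /= /dsum_comul /= !linear0 addr0.
by rewrite {1}/counit /= /dsum_counit /= linear0 addr0.
Qed.

Lemma coalg_inr_comorph (C D : coalgType k) : comorph (@coalg_inr k C D).
Proof.
split=> x; first by rewrite {1}/comul /= /dsum_comul /= !linear0 add0r.
by rewrite {1}/counit /= /dsum_counit /= linear0 add0r.
Qed.

Lemma tens_map0 (U V W X : vectType k) (f : U -> W) (g : V -> X) t :
  (forall u, f u = 0) -> tens_map f g t = 0.
Proof.
move=> f0; rewrite /tens_map /tens_lift big1 // => i _; rewrite big1 // => j _.
by rewrite f0 tpure0l scaler0.
Qed.

Lemma pair_split (C D : coalgType k) (x : C * D) :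
  x = coalg_inl D x.1 + coalg_inr C x.2.
Proof. by case: x => c d; congr pair; rewrite /= ?addr0 ?add0r. Qed.

Definition grouplike (C : coalgType k) (x : C) : Prop := comul x = x \ox x.

Lemma grouplike_pair (C D : coalgType k) (x : C * D) :
  grouplike x -> grouplike x.1 /\ grouplike x.2.
Proof.
rewrite /grouplike {1}/comul /= /dsum_comul /= => dx.
pose p1 : {linear (C * D)%type -> C} := fst.
pose p2 : {linear (C * D)%type -> D} := snd.
split.
  have := congr1 (tens_map p1 p1) dx; rewrite tens_mapE /= => <-.
  rewrite linearD /= !tens_map_comp [X in _ + X]tens_map0 // addr0.
  exact/esym/tens_map_id.
have := congr1 (tens_map p2 p2) dx; rewrite tens_mapE /= => <-.
rewrite linearD /= !tens_map_comp [X in X + _]tens_map0 // add0r.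
exact/esym/tens_map_id.
Qed.

(** The equation says m_ab m_cd = 0 for b different from c, and m_ab m_bd = m_ad. Hence the square
    of m_ad is m_ab m_bd m_ac m_cd, which contains m_ab m_cd = 0. *)
Lemma grouplike_mxcoalg n (m : mxcoalg n k) : (1 < n)%N -> grouplike m -> m = 0.
Proof.
move=> n1 gm.
have mE a b c d : m a b * m c d = (c == b)%:R * m a d.
  have lev : scalar (fun x : mxcoalg n k => x a b).
    by move=> u x y; rewrite !mxE.
  have [ev evE] : exists ev : {scalar mxcoalg n k}, forall x, ev x = x a b.
    by exists (pack_scalar lev).
  have hev i j : hitl ev (mxcoalg_basis k i j : mxcoalg n k)
      = (i == a)%:R *: (mxcoalg_basis k b j : mxcoalg n k).
    rewrite (hitl_sum _ (mxcoalg_comulE _ i j)) (bigD1 b) //= big1 => [|r /negPf rb].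
      by rewrite addr0 evE mxE eqxx andbT eq_sym.
    by rewrite evE mxE [b == r]eq_sym rb andbF scale0r.
  have : hitl ev m = m a b *: m by rewrite /hitl gm tens_hitlE evE.
  have -> : hitl ev m = \sum_j m a j *: (mxcoalg_basis k b j : mxcoalg n k).
    have {1}-> : m = \sum_i \sum_j m i j *: (mxcoalg_basis k i j : mxcoalg n k).
      exact: matrix_sum_delta.
    rewrite linear_sum (bigD1 a) //= [X in _ + X]big1 => [|i /negPf ia].
      rewrite addr0 linear_sum; apply: eq_bigr => j _.
      by rewrite linearZ /= hev eqxx scale1r.
    rewrite linear_sum big1 // => j _.
    by rewrite linearZ /= hev ia scale0r scaler0.
  move=> /matrixP/(_ c d); rewrite summxE [RHS]mxE => <-.
  rewrite (bigD1 d) //= big1 => [|j /negPf jd].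
    by rewrite addr0 !mxE eqxx andbT mulrC.
  by rewrite !mxE [d == j]eq_sym jd andbF mulr0.
apply/matrixP => a d; rewrite [RHS]mxE.
have n0 : (0 < n)%N by apply: ltnW.
pose b := Ordinal n0; pose c := Ordinal n1.
apply/eqP; rewrite -[_ == 0]orbb -mulf_eq0.
have E e : m a d = m a e * m e d by rewrite mE eqxx mul1r.
by rewrite {1}(E b) (E c) [m a c * _]mulrC mulrACA mE mul0r mul0r.
Qed.

End CoalgebraMorphisms.

Section CoradicalModel.
Variables (k : fieldType) (H : bialgType k).
Local Notation H0 := (coradical_space H).

Lemma coradical_iso (D : coalgType k) : coalg_iso (subcoalg_of (coradical H)) D ->
  exists g : {linear D -> H}, exists g' : {linear H -> D},
    [/\ cancel g g', comorph g & limg (linfun g) = H0].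
Proof.
move=> [f [[f' fK f'K] df ef]].
pose mf' := GRing.isLinear.Build k D (subcoalg_of (coradical H)) _ _
  (can2_linear fK f'K).
pose F : {linear D -> subcoalg_of (coradical H)} := HB.pack f' mf'.
pose i : {linear subcoalg_of (coradical H) -> H} :=
  (vsval : subvs_of (coradical H) -> H).
pose p : {linear H -> subcoalg_of (coradical H)} := vsproj (coradical H).
exists (i \o F), (f \o p); split.
- by move=> d /=; rewrite /p vsvalK f'K.
- apply: comorph_comp.
    by split=> x //; apply: subcoalg_comulE.
  split=> d; last by rewrite -ef /= f'K.
  rewrite -{2}[d]f'K df tens_map_comp.
  rewrite (eq_tens_map (f' := idfun) (g' := idfun)) ?tens_map_id //.
apply/vspaceP => x; apply/memv_imgP/idP => [[d _ ->]|xH].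
  by rewrite lfunE; apply: subvsP.
exists (f (p x)); first exact: memvf.
by rewrite lfunE /= fK /p /i vsprojK.
Qed.

Lemma comorph_mx_corep n (g : {linear mxcoalg n k -> H}) : comorph g ->
  corep (\matrix_(i, j) g (mxcoalg_basis k i j)).
Proof.
move=> [dg eg]; split=> [|i j].
  by apply/matrixP => i j; rewrite !mxE eg; apply: mxcoalg_counitE.
rewrite mxE dg [comul _](mxcoalg_comulE k i j) linear_sum.
by apply: eq_bigr => r _; rewrite /= tens_mapE !mxE.
Qed.

Lemma lincomb_mxcoalg n (g : {linear mxcoalg n k -> H}) (c : mxcoalg n k) :
  lincomb (\matrix_(i, j) g (mxcoalg_basis k i j)) c = g c.
Proof.
have {2}-> : c = \sum_i \sum_j c i j *: mxcoalg_basis k i j by apply: matrix_sum_delta.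
rewrite linear_sum; apply: eq_bigr => i _; rewrite linear_sum.
by apply: eq_bigr => j _; rewrite linearZ mxE.
Qed.

Lemma comorph_mx_indep n (g : {linear mxcoalg n k -> H}) : injective g ->
  indep (\matrix_(i, j) g (mxcoalg_basis k i j)).
Proof. by move=> gI c d; rewrite !lincomb_mxcoalg => /gI. Qed.

Lemma unit_model (g : {linear subcoalg_of (unit_subcoalg H) -> H}) c0 c :
  g c0 = 1 -> exists a, g c = a *: 1.
Proof.
move=> g1; have [a0 a0E] := vlineP _ _ (subvsP c0).
have [a aE] := vlineP _ _ (subvsP c).
have a00 : a0 != 0.
  apply: contra_eq_neq g1 => z; have -> : c0 = 0.
    by apply: val_inj; rewrite /= a0E z scale0r.
  by rewrite linear0 eq_sym oner_neq0.
exists (a / a0); rewrite -g1 -linearZ; congr (g _).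
by apply: val_inj; rewrite /= aE a0E scalerA divfK.
Qed.

(* A coalgebra isomorphism need not a priori send the summand k 1 of the model to
   k 1; it does because there are no grouplike elements in M^c(n, k), n > 1. *)
Lemma unit_grouplike (D : coalgType k) (g : {linear D -> H}) (g' : {linear H -> D}) :
  cancel g g' -> comorph g -> 1 \in limg (linfun g) ->
  exists2 d, grouplike d & g d = 1.
Proof.
move=> gK [dg _] /memv_imgP[d _]; rewrite lfunE => g1; exists d => //.
have : tens_map g g (comul d) = tens_map g g (d \ox d).
  by rewrite -dg tens_mapE -[g d]g1 comul1.
move=> /(congr1 (tens_map g' g')); rewrite !tens_map_comp.
have E : g' \o g = idfun by apply/funext.
by rewrite E !tens_map_id.
Qed.

End CoradicalModel.

(** * Exclusion of the coradicals (ii), (iii) and (iv) *)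

Section KillBlocks.
Variables (k : fieldType) (H : hopfAlgType k).
Implicit Types f : {scalar H}.
Local Notation H0 := (coradical_space H).

(* On the image of g, the functional f is the projection to the unit. *)
Definition killed (D : coalgType k) (g : D -> H) : Prop :=
  exists2 f, central_idem f & forall d, hitr f (g d) = f (g d) *: 1.

Lemma killed_unit (g : {linear subcoalg_of (unit_subcoalg H) -> H}) c0 :
  g c0 = 1 -> killed g.
Proof.
move=> g1; exists counit.
  split=> [x|x||x]; rewrite ?hitl_counit ?hitr_counit ?counit1 //.
  by rewrite subrr mem0v.
move=> d; have [a ->] := unit_model d g1.
by rewrite hitr_counit linearZ /= counit1 mulr1.
Qed.

(** The functional is f1 * f2, with f2 from [block_functional]: on the image of C, f1 already
    projects to the unit, where f2 is 1; on the new block f2 acts as 0. *)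
Lemma killed_pair (C : coalgType k) n (g : {linear (C * mxcoalg n k)%type -> H}) :
  (1 < n)%N -> (\dim {:H} - \dim H0 < n * n)%N -> injective g -> comorph g ->
  killed (g \o coalg_inl (mxcoalg n k)) -> killed g.
Proof.
move=> n1 codim gI mg [f1 cf1 f1C].
pose h : {linear mxcoalg n k -> H} := g \o @coalg_inr k C (mxcoalg n k).
have mh : comorph h by apply: comorph_comp => //; apply: coalg_inr_comorph.
have hI : injective h by move=> x y /gI[].
have cT := comorph_mx_corep mh; have iT := comorph_mx_indep hI.
have [f2 cf2 f2T] := block_functional n1 cT iT codim.
exists (f2 \o hitl f1); first exact: central_idem_comp.
have [c1 _ _ _] := cf1; have [c2 _ u2 _] := cf2.
move=> d; rewrite (pair_split d) !linearD scalerDl; congr (_ + _).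
  have := f1C d.1; rewrite /= => f1d.
  rewrite hitr_comp -c1 hitlr /= c1 f1d !linearZ /= -c2 hitl1 u2.
  by rewrite scale1r mulr1.
set T := \matrix_(i, j) h (mxcoalg_basis k i j) in cT iT f2T.
have -> : g (coalg_inr C d.2) = lincomb T d.2 by rewrite (lincomb_mxcoalg h).
have E : hitr f2 (lincomb T d.2) = 0.
  by rewrite hitr_lincomb // f2T trmx0 mulmx0 linear0.
by rewrite /= hitr_comp hit_adj E !linear0 scale0r.
Qed.

Lemma killed_coradical (D : coalgType k) (g : {linear D -> H}) :
  killed g -> limg (linfun g) = H0 ->
  exists2 f, central_idem f & forall x, x \in H0 -> hitr f x = f x *: 1.
Proof.
move=> [f cf fg] gH; exists f => // x; rewrite -gH => /memv_imgP[d _ ->].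
by rewrite lfunE.
Qed.

End KillBlocks.

Section NoGrouplikes.
Variables (k : closedFieldType) (H : hopfAlgType k).
Hypothesis char0 : [pchar k] =i pred0.

Lemma inl_inj (C D : coalgType k) (g : {linear (C * D)%type -> H}) :
  injective g -> injective (g \o @coalg_inl k C D).
Proof. by move=> gI x y /gI[]. Qed.

Lemma grouplike_inl (C : coalgType k) n (d : (C * mxcoalg n k)%type) :
  (1 < n)%N -> grouplike d -> d = coalg_inl (mxcoalg n k) d.1 /\ grouplike d.1.
Proof.
move=> n1 /grouplike_pair[d1 /(grouplike_mxcoalg n1) d2]; split=> //.
by rewrite {1}(pair_split d) d2 linear0 addr0.
Qed.

Lemma killed_dim (D : coalgType k) (g : {linear D -> H}) :
  killed g -> injective g -> limg (linfun g) = coradical_space H ->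
  dim D = \dim {:H}.
Proof.
move=> kg gI gH; have [f cf fH0] := killed_coradical kg gH.
by rewrite -(dim_limg_inj gI) gH (coradical_full char0 cf fH0).
Qed.

Lemma dim_pair (C D : vectType k) : dim (C * D)%type = (dim C + dim D)%N.
Proof. by []. Qed.

Lemma dim_unit : dim (subcoalg_of (unit_subcoalg H)) = 1%N.
Proof. by rewrite -[LHS]/(\dim <[1 : H]>) dim_vline oner_neq0. Qed.

Local Notation U := (subcoalg_of (unit_subcoalg H)).
Local Notation M n := (mxcoalg n k).

Hypothesis dimH : \dim {:H} = 16%N.

(** The codimension 16 - 10 = 6 is below 9, so the block splits off and the model would have
    dimension 16. *)
Lemma no_coradical_M3 : ~ coalg_iso (subcoalg_of (coradical H)) (U * M 3)%type.
Proof.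
move=> /coradical_iso[g [g' [gK mg gH]]]; have gI := can_inj gK.
have [d gd g1] : exists2 d, grouplike d & g d = 1.
  by apply: unit_grouplike gK mg _; rewrite gH mem1_coradical.
have [dE _] := grouplike_inl (isT : 1 < 3)%N gd; rewrite dE in g1.
have dimH0 : \dim (coradical_space H) = 10%N.
  by rewrite -gH dim_limg_inj // dim_pair dim_unit.
have kg : killed g.
  apply: killed_pair => //; first by rewrite dimH dimH0.
  exact: (killed_unit (g := g \o coalg_inl (M 3))) g1.
by have := killed_dim kg gI gH; rewrite dim_pair dim_unit dimH.
Qed.

Lemma no_coradical_M2M3 :
  ~ coalg_iso (subcoalg_of (coradical H)) (U * M 2 * M 3)%type.
Proof.
move=> /coradical_iso[g [g' [gK mg gH]]]; have gI := can_inj gK.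
have [d gd g1] : exists2 d, grouplike d & g d = 1.
  by apply: unit_grouplike gK mg _; rewrite gH mem1_coradical.
have [dE gd1] := grouplike_inl (isT : 1 < 3)%N gd; have [dE1 _] := grouplike_inl (isT : 1 < 2)%N gd1.
rewrite dE dE1 in g1.
have dimH0 : \dim (coradical_space H) = 14%N.
  by rewrite -gH dim_limg_inj // !dim_pair dim_unit.
have kg : killed g.
  apply: killed_pair => //; first by rewrite dimH dimH0.
  apply: killed_pair => //; first by rewrite dimH dimH0.
  - exact: inl_inj.
  - by apply: comorph_comp => //; apply: coalg_inl_comorph.
  exact: (killed_unit (g := g \o coalg_inl (M 3) \o coalg_inl (M 2))) g1.
by have := killed_dim kg gI gH; rewrite !dim_pair dim_unit dimH.
Qed.

(** The codimension 16 - 13 = 3 is just below 4, and the three blocks are removed one after the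
    other. *)
Lemma no_coradical_M2M2M2 :
  ~ coalg_iso (subcoalg_of (coradical H)) (U * M 2 * M 2 * M 2)%type.
Proof.
move=> /coradical_iso[g [g' [gK mg gH]]]; have gI := can_inj gK.
have [d gd g1] : exists2 d, grouplike d & g d = 1.
  by apply: unit_grouplike gK mg _; rewrite gH mem1_coradical.
have [dE gd1] := grouplike_inl (isT : 1 < 2)%N gd; have [dE1 gd2] := grouplike_inl (isT : 1 < 2)%N gd1.
have [dE2 _] := grouplike_inl (isT : 1 < 2)%N gd2.
rewrite dE dE1 dE2 in g1.
have dimH0 : \dim (coradical_space H) = 13%N.
  by rewrite -gH dim_limg_inj // !dim_pair dim_unit.
have m1 := comorph_comp mg (coalg_inl_comorph _ (M 2)).
have kg : killed g.
  apply: killed_pair => //; first by rewrite dimH dimH0.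
  apply: killed_pair => //; first by rewrite dimH dimH0.
    exact: inl_inj.
  apply: killed_pair => //; first by rewrite dimH dimH0.
  - by do 2!apply: inl_inj.
  - by apply: comorph_comp m1 _; apply: coalg_inl_comorph.
  exact: (killed_unit
    (g := g \o coalg_inl (M 2) \o coalg_inl (M 2) \o coalg_inl (M 2))) g1.
by have := killed_dim kg gI gH; rewrite !dim_pair dim_unit dimH.
Qed.

End NoGrouplikes.

(** * Characters of comodules, tensor products and the regular comodule *)

Section Trace.
Variables (k : fieldType) (H : bialgType k).
Implicit Types g : {scalar H}.

Lemma functional_trace n (T : 'M[H]_n) g : g (\tr T) = \tr (map_mx g T).
Proof. by rewrite linear_sum; apply: eq_bigr => i _; rewrite mxE. Qed.

Lemma conj_trace n (T : 'M[H]_n) (P P' : 'M[k]_n) : P *m P' = 1%:M ->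
  \tr (smx P *m T *m smx P') = \tr T.
Proof.
move=> /mulmx1C P'P; apply: functional_ext => g.
rewrite !functional_trace map_mul_smx map_smx_mul mxtrace_mulC mulmxA.
by rewrite P'P mul1mx.
Qed.

Lemma hitl_trace n (T : 'M[H]_n) g : corep T -> hitl g (\tr T) = hitr g (\tr T).
Proof.
move=> cT; rewrite !linear_sum /=.
under eq_bigr => i _ do rewrite (hitl_sum _ (cT.2 i i)).
under [RHS]eq_bigr => i _ do rewrite (hitr_sum _ (cT.2 i i)).
exact: exchange_big.
Qed.

Lemma lincomb_scalar n (T : 'M[H]_n) a : lincomb T a%:M = a *: \tr T.
Proof.
rewrite /lincomb scaler_sumr; apply: eq_bigr => i _.
rewrite (bigD1 i) //= big1 => [|j /negPf ji]; first by rewrite mxE eqxx addr0.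
by rewrite mxE eq_sym ji scale0r.
Qed.

Lemma counit_trace n (T : 'M[H]_n) : corep T -> counit (\tr T) = n%:R.
Proof. by move=> cT; rewrite functional_trace corep_map_counit // mxtrace1. Qed.

Lemma indep_trace_neq0 n (T : 'M[H]_n) : (0 < n)%N -> indep T -> \tr T != 0.
Proof.
move=> n0 iT; apply/eqP => t0.
have : 1%:M = 0 :> 'M[k]_n by apply: iT; rewrite lincomb_scalar t0 scaler0 linear0.
by move=> /matrixP/(_ (Ordinal n0) (Ordinal n0)); rewrite !mxE eqxx; apply/eqP/oner_neq0.
Qed.

(** The hypothesis makes the coefficient matrix commute with matrix units, so it is scalar. *)
Lemma cocommutative_coef n (T : 'M[H]_n) x : (0 < n)%N -> corep T -> indep T ->
  x \in coef T -> (forall g, hitl g x = hitr g x) -> exists a, x = a *: \tr T.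
Proof.
move=> n0 cT iT /coefP[c ->] cocom; pose o := Ordinal n0.
exists (c o o); rewrite -lincomb_scalar; congr (lincomb T _).
apply/matrixP => a j; rewrite mxE.
have [g gT] := indep_functional iT a o.
have := cocom g; rewrite hitl_lincomb // hitr_lincomb // gT trmx_delta => /iT.
move=> /matrixP/(_ o j); rewrite !mxE.
rewrite (bigD1 a) //= big1 => [|i /negPf ia]; last by rewrite mxE ia andbF mul0r.
rewrite (bigD1 o) //= big1 => [|i /negPf ia]; last by rewrite mxE ia mulr0.
by rewrite !mxE !eqxx mul1r !addr0 => ->; rewrite eq_sym mulr_natr.
Qed.

End Trace.

Section TensorProduct.
Variables (k : fieldType) (H : bialgType k) (n p : nat).
Variables (T : 'M[H]_n) (U : 'M[H]_p).

(** The Kronecker product, for the tensor product of comodules; pairs of indices are numbered by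
    [enum_rank]. *)
Definition kron : 'M[H]_#|{: 'I_n * 'I_p}| :=
  \matrix_(x, y) (T (enum_val x).1 (enum_val y).1 * U (enum_val x).2 (enum_val y).2).

Lemma kronE a b c d :
  kron (enum_rank (a, c)) (enum_rank (b, d)) = T a b * U c d.
Proof. by rewrite mxE !enum_rankK. Qed.

Lemma kron_corep : corep T -> corep U -> corep kron.
Proof.
move=> cT cU; split=> [|x y].
  apply/matrixP => x y; rewrite !mxE counitM !corep_counit // -natrM mulnb.
  rewrite -[x == y](inj_eq enum_val_inj).
  by case: (enum_val x) (enum_val y) => a b [c d].
rewrite mxE comulM cT.2 cU.2.
rewrite -[tens_mul _ _]/(tens_mull _ _) linear_sum.
under eq_bigr => r _ do rewrite /= /tens_mull linear_sum.
rewrite pair_big (reindex _ (onW_bij _ (enum_val_bij _))).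
by apply: eq_bigr => z _; rewrite /= tens_mulE !mxE.
Qed.

Lemma kron_trace : \tr kron = \tr T * \tr U.
Proof.
rewrite mulr_suml; under [RHS]eq_bigr => i _ do rewrite mulr_sumr.
rewrite pair_big (reindex _ (onW_bij _ (enum_val_bij _))).
by apply: eq_bigr => z _; rewrite mxE.
Qed.

End TensorProduct.

Section RegularTrace.
Variables (k : fieldType) (H : hopfAlgType k).
Implicit Types g : {scalar H}.

Lemma hitr_mul g x h (I : finType) (a b : I -> H) :
  comul x = \sum_i a i \ox b i ->
  hitr g (x * h) = \sum_i a i * hitr (shiftf g (b i)) h.
Proof.
move=> dx; rewrite /hitr comulM dx -[tens_mul _ _]/(tens_mull _ _).
rewrite (linear_sum (tens_mull (comul h))) linear_sum; apply: eq_bigr => i _ /=.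
rewrite -/(hitr _ h) (hitr_sum _ (comul_base h)) /tens_mull (comul_base h).
rewrite (linear_sum (tens_mul (a i \ox b i))) linear_sum mulr_sumr.
by apply: eq_bigr => j _; rewrite /= tens_mulE tens_hitrE -scalerAr.
Qed.

Lemma hitr_shift n (T : 'M[H]_n) g i l h : corep T ->
  hitr (shiftf g (T i l)) h = \sum_j dual_corep T j i * hitr g (T j l * h).
Proof.
move=> cT.
under eq_bigr => j _ do rewrite (hitr_mul _ _ (cT.2 j l)) mulr_sumr.
rewrite exchange_big /= (bigD1 i) //= [X in _ + X]big1 => [|r /negPf ri].
  under eq_bigr => j _ do rewrite mulrA.
  by rewrite -mulr_suml sum_dual_corep // eqxx mul1r addr0.
under eq_bigr => j _ do rewrite mulrA.
by rewrite -mulr_suml sum_dual_corep // eq_sym ri mul0r.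
Qed.

Lemma amullE (x y : H) : amull x y = x * y.
Proof. by rewrite lfunE. Qed.

Definition optrace (F : H -> H) : k := \sum_a coordf a (F (tbase a)).

Lemma optraceC (F G : {linear H -> H}) : optrace (F \o G) = optrace (G \o F).
Proof.
have E (A B : {linear H -> H}) : optrace (A \o B) =
    \sum_a \sum_b coordf b (B (tbase a)) * coordf a (A (tbase b)).
  apply: eq_bigr => a _; rewrite /= {1}(coordf_sum (B (tbase a))) !linear_sum.
  by apply: eq_bigr => b _; rewrite !linearZ.
rewrite !E exchange_big; apply: eq_bigr => b _; apply: eq_bigr => a _.
exact: mulrC.
Qed.

Lemma optrace_hitr g : optrace (hitr g) = g (\tr reg_corep).
Proof.
rewrite linear_sum; apply: eq_bigr => a _ /=.
rewrite (hitr_sum _ (comul_tbase a)) linear_sum (bigD1 a) //= big1 => [|b /negPf ba].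
  by rewrite linearZ /= coordf_base eqxx mulr1 addr0.
by rewrite linearZ /= coordf_base eq_sym ba mulr0.
Qed.

(* The isomorphism V (x) H = V_triv (x) H of comodules, at the level of traces. *)
Lemma trace_mul_reg n (T : 'M[H]_n) : corep T ->
  \tr T * \tr reg_corep = \tr (reg_corep : 'M[H]_(dim H)) *+ n.
Proof.
move=> cT; apply: functional_ext => g.
rewrite mulr_suml linear_sum raddfMn /=.
under eq_bigr => i _ do rewrite -[g _]/(shiftf g (T i i) _) -optrace_hitr.
(* Expand by [hitr_shift] and use cyclicity of the trace; for each j, the sum over i of
   [T j i * dual_corep T j i] is 1, leaving n equal traces. *)
transitivity (\sum_i \sum_j optrace (hitr g \o amull (T j i) \o amull (dual_corep T j i))).
  apply: eq_bigr => i _.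
  transitivity (\sum_j optrace (amull (dual_corep T j i) \o (hitr g \o amull (T j i)))).
    rewrite /optrace exchange_big; apply: eq_bigr => a _ /=.
    rewrite hitr_shift // linear_sum; apply: eq_bigr => j _.
    by rewrite !amullE.
  by apply: eq_bigr => j _; rewrite optraceC.
rewrite exchange_big -[RHS]mulr_natr mulr_natr -optrace_hitr -[n in RHS]card_ord -sumr_const.
apply: eq_bigr => j _; rewrite /optrace exchange_big; apply: eq_bigr => a _ /=.
rewrite -!linear_sum; congr (coordf a (hitr g _)).
under eq_bigr => i _ do rewrite !amullE mulrA.
by rewrite -mulr_suml sum_corep_dual // eqxx mul1r.
Qed.

End RegularTrace.

(** * Exclusion of the coradical (i) *)

Section OneBlock.
Variables (k : closedFieldType) (H : bialgType k).
Hypothesis char0 : [pchar k] =i pred0.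
Local Notation H0 := (coradical_space H).
Variables (T : 'M[H]_2) (f : {scalar H}).
Hypotheses (cT : corep T) (iT : indep T).
Hypothesis fH0 : forall x, x \in H0 -> hitr f x = f x *: 1.
Hypothesis fcoef : forall x, x \in H0 -> f x = 0 -> x \in coef T.

(** A nontrivial V has f(V) = 0, so its entries lie in [coef T] and its cocommutative trace is c
    times that of T. The counit gives n = 2 c with n at most 2; n = 2 gives c = 1. *)
Lemma irr_trace n (V : 'M[H]_n) : (0 < n)%N -> corep V -> indep V ->
  n = 1%N /\ V = 1%:M \/ n = 2%N /\ \tr V = \tr T.
Proof.
move=> n0 cV iV; have [fV|] := indep_trivial n0 cV iV fH0; [right | by left].
have VT i j : V i j \in coef T.
  have /matrixP/(_ i j) := fV; rewrite !mxE; apply: fcoef.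
  by apply: (subvP (coef_coradical cV iV n0)); apply: mem_coef.
have n2 : (n <= 2)%N.
  by rewrite -leq_sqr -mulnn -(dim_coef iV) -[(2 ^ 2)%N]/(2 * 2)%N -(dim_coef iT)
     dimvS // coef_sub.
have [c trV] : exists c, \tr V = c *: \tr T.
  apply: cocommutative_coef => // [|g]; last exact: hitl_trace.
  by rewrite memv_suml.
have nc : n%:R = c * 2%:R.
  by rewrite -(counit_trace cV) -(counit_trace cT) trV linearZ.
have c0 : c != 0.
  apply: contraTneq n0 => c0; move: nc; rewrite c0 mul0r => /eqP.
  by rewrite ((pcharf0P k).1 char0) -leqn0 leqNgt.
case: n n0 V cV iV fV VT n2 trV nc => [//|[|[|//]]] _ V cV iV _ _ _ trV nc.
  (* If n = 1, the entry of V is grouplike and equals c [\tr T]. The functional dual to [T 0 1] acts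
     on it by 0 in the first description, and gives c [T 1 0] in the second. *)
  have [g gT] := indep_functional iT 0 1.
  have gtr : g (\tr T) = 0.
    rewrite functional_trace gT /mxtrace big1 // => -[[|[|//]] ?] _.
      by rewrite mxE.
    by rewrite mxE.
  have : hitl g (\tr V) = 0.
    have VE : V 0 0 = c *: \tr T by rewrite -trV [RHS]big_ord1.
    rewrite [\tr V]big_ord1 (hitl_sum _ (cV.2 0 0)) big_ord1.
    have -> : g (V 0 0) = 0 by rewrite VE; apply: etrans (linearZ _ _) _; rewrite gtr /= mulr0.
    exact: scale0r.
  rewrite trV -lincomb_scalar hitl_lincomb // gT trmx_delta mul_mx_scalar.
  rewrite linearZ /= lincomb_delta => /eqP; rewrite scaler_eq0 (negPf c0) /=.
  by rewrite (negPf (indep_neq0 _ _ iT)).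
split=> //; rewrite trV; suff -> : c = 1 by rewrite scale1r.
have nz : 2%:R != 0 :> k by apply: natr_neq0.
by apply: (mulIf nz); rewrite mul1r.
Qed.

(** Along a composition series, a counts the trivial constituents and b those with the character of
    T. For the last clause, the component of a coinvariant vector in a two-dimensional subcomodule
    vanishes by [indep_fixed], so the vector survives in the quotient. *)
Lemma trace_decomp n (V : 'M[H]_n) : corep V -> exists a b : nat,
  [/\ n = (a + b * 2)%N, \tr V = a%:R + \tr T *+ b, b = 0%N -> V = 1%:M
    & (exists2 c : 'cV[k]_n, c != 0 & V *m smx c = smx c) -> (0 < a)%N].
Proof.
move: n V; apply: corep_ind => [V|n V P P' cV PP' [a [b [nE tr b0 fx]]]|].
- exists 0%N, 0%N; split=> //; first by rewrite /mxtrace big_ord0 mulr0n addr0.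
    by move=> _; apply/matrixP => -[].
  by move=> [c /eqP[]]; apply/matrixP => -[].
- have P'P := mulmx1C PP'.
  have K : smx P' *m smx P = 1%:M :> 'M[H]_n by rewrite -smxM P'P smx1.
  exists a, b; split=> // [|bz|[c c0 Vc]]; first by rewrite -tr conj_trace.
    have := congr1 (fun A => smx P' *m A *m smx P) (b0 bz).
    rewrite mulmx1 K !mulmxA K mul1mx -mulmxA => <-.
    by rewrite K mulmx1.
  apply: fx; exists (P *m c).
    by apply: contra_neq c0 => Pc; rewrite -[c]mul1mx -P'P -mulmxA Pc mulmx0.
  rewrite !smxM mulmxA -[_ *m smx P' *m smx P]mulmxA K mulmx1.
  by rewrite -mulmxA Vc.
move=> m n T1 X T2 m0 cT1 iT1 cT2 cB [a [b [nE tr b0 fx]]].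
have [[m1 T11]|[m2 tr1]] := irr_trace m0 cT1 iT1.
  move: T1 X m0 cT1 iT1 cB T11; rewrite m1 => T1 X _ _ _ cB T11.
  exists a.+1, b; split=> //; first by rewrite nE addSn.
    by rewrite mxtrace_block tr T11 mxtrace1 addrA -natrD add1n.
  move=> bz; have T21 := b0 bz; rewrite T11 T21 -[RHS]/(scalar_mx 1).
  rewrite [RHS]scalar_mx_block; congr block_mx; apply: trivial_extension => // i.
  rewrite (comul_block cB) big_ord1 T11 T21 mxE eqxx; congr (_ + _).
  rewrite (bigD1 i) //= big1 => [|r /negPf ri]; first by rewrite mxE eqxx addr0.
  by rewrite mxE eq_sym ri tpure0l.
move: T1 X m0 cT1 iT1 cB tr1; rewrite m2 => T1 X _ _ iT1 cB tr1.
exists a, b.+1; split=> //; first by rewrite nE; lia.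
  by rewrite mxtrace_block tr tr1 mulrS addrCA.
move=> [c c0]; set u := usubmx c; set d := dsubmx c.
rewrite -[c]vsubmxK -/u -/d -[smx _]/(map_mx _ _) map_col_mx -!/(smx _).
rewrite mul_block_col mul0mx addr0 => /eq_col_mx[fu fd].
have u0 : u = 0.
  apply/matrixP => i j; rewrite ord1 [RHS]mxE.
  apply: (indep_fixed iT1 (c := fun i => u i 0)) => // l.
  by rewrite -mul_smxE fu mxE.
apply: fx; exists d; last by rewrite -[RHS]fd u0 smx0 mulmx0 add0r.
by apply: contra_neq c0 => d0; rewrite -[c]vsubmxK -/u -/d u0 d0 col_mx0.
Qed.

End OneBlock.

Section NoM2.
Variables (k : closedFieldType) (H : hopfAlgType k).
Hypothesis char0 : [pchar k] =i pred0.

Lemma natr_inj : injective (fun n : nat => n%:R : k).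
Proof.
have half m n : (m <= n)%N -> m%:R = n%:R :> k -> m = n.
  move=> mn /eqP; rewrite eq_sym -subr_eq0 -natrB // ((pcharf0P k).1 char0) subn_eq0.
  by move=> nm; apply/eqP; rewrite eqn_leq mn.
by move=> m n; case: (leqP m n) => [|/ltnW] mn E; [|symmetry]; apply: half.
Qed.

(** Otherwise an off-diagonal [T i j] would annihilate all entries of the dual, hence also 1, which
    is a combination of them by the antipode identity. *)
Lemma kron_dual_neq1 n (T : 'M[H]_n) : (1 < n)%N -> corep T -> indep T ->
  kron T (dual_corep T) <> 1%:M.
Proof.
move=> n1 cT iT K1; pose i := Ordinal (ltnW n1); pose j := Ordinal n1.
have Z c d : T i j * dual_corep T c d = 0.
  rewrite -kronE K1 mxE (inj_eq enum_rank_inj).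
  by case: eqP => // -[].
apply/negP: (indep_neq0 i j iT); rewrite negbK -[T i j]mulr1.
have <- : \sum_r dual_corep T r i * T r i = 1 by rewrite sum_dual_corep // eqxx.
by rewrite mulr_sumr big1 // => l _; rewrite mulrA Z mul0r.
Qed.

Hypothesis dimH : \dim {:H} = 16%N.

(** The codimension 16 - 5 = 11 is too large for [block_functional], so characters are counted
    instead. *)
Lemma no_coradical_M2 : ~ coalg_iso (subcoalg_of (coradical H))
  (subcoalg_of (unit_subcoalg H) * mxcoalg 2 k)%type.
Proof.
move=> /coradical_iso[g [g' [gK mg gH]]]; have gI := can_inj gK.
have [d gd g1] : exists2 d, grouplike d & g d = 1.
  by apply: unit_grouplike gK mg _; rewrite gH mem1_coradical.
have [dE _] := grouplike_inl (isT : 1 < 2)%N gd; rewrite dE in g1.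
pose h : {linear mxcoalg 2 k -> H} :=
  g \o @coalg_inr k (subcoalg_of (unit_subcoalg H)) (mxcoalg 2 k).
have mh : comorph h by apply: comorph_comp => //; apply: coalg_inr_comorph.
have hI : injective h by move=> x y /gI[].
have cT := comorph_mx_corep mh; have iT := comorph_mx_indep hI.
have hE := lincomb_mxcoalg h.
set T := \matrix_(i, j) h (mxcoalg_basis k i j) in cT iT hE.
have n1T : 1 \notin coef T.
  apply/negP => /coefP[c]; rewrite hE -g1 => /gI[d1 _].
  by move: g1; rewrite d1 !linear0 => /eqP; rewrite eq_sym oner_eq0.
have [f [f1 fT]] := sep_functional n1T.
have fT0 : map_mx f T = 0 by apply/matrixP => i j; rewrite [LHS]mxE [RHS]mxE fT // mem_coef.
have dec x : x \in coradical_space H -> exists a, exists2 y, y \in coef T & x = a *: 1 + y.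
  rewrite -gH => /memv_imgP[e _ ->]; rewrite lfunE (pair_split e) linearD.
  have [a aE] := unit_model (g := g \o coalg_inl (mxcoalg 2 k)) e.1 g1.
  exists a; exists (h e.2); last by rewrite -aE.
  by apply/coefP; exists e.2; rewrite hE.
have fH0 x : x \in coradical_space H -> hitr f x = f x *: 1.
  move=> /dec[a [y yT ->]]; rewrite !linearD !linearZ /= f1 fT // mulr1 addr0.
  rewrite /hitr comul1 -/(hitr f y) tens_hitrE f1 scale1r.
  by have /coefP[c ->] := yT; rewrite hitr_lincomb // fT0 trmx0 mulmx0 linear0 addr0.
have fcoef x : x \in coradical_space H -> f x = 0 -> x \in coef T.
  move=> /dec[a [y yT ->]]; rewrite linearD linearZ /= f1 fT // mulr1 addr0 => ->.
  by rewrite scale0r add0r.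
have irr := irr_trace char0 cT iT fH0 fcoef.
have decomp := trace_decomp char0 cT iT fH0 fcoef.
have cU := dual_corepP cT.
have trU : \tr (dual_corep T) = \tr T.
  by have [[]|[]] := irr _ _ (ltn0Sn _) cU (indep_dual iT).
have [a [b [ab trR _ apos]]] := decomp _ _ (reg_corepP H).
have [m [l [ml trK K1 _]]] := decomp _ _ (kron_corep cT cU).
rewrite kron_trace trU in trK; rewrite card_prod !card_ord in ml.
have a0 : (0 < a)%N.
  (* The unit of H is a coinvariant vector of the regular comodule. *)
  apply: apos; exists (\col_i coordf i 1).
    apply/eqP => /matrixP Z; have : (1 : H) = 0.
      by apply: coordf_ext => i; have := Z i 0; rewrite !mxE linear0.
    exact/eqP/oner_neq0.
  apply/matrixP => i j; rewrite ord1 mul_smxE; transitivity (hitl (coordf i) (1 : H)).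
    by rewrite hitl_coordf; apply: eq_bigr => r _; rewrite mxE.
  by rewrite hitl1 !mxE.
have l0 : l <> 0%N by move=> /K1; apply: kron_dual_neq1.
have nzT : \tr T != 0 by apply: indep_trace_neq0 iT.
have ftr : f (\tr T) = 0 by rewrite functional_trace fT0 mxtrace0.
have fn n : f n%:R = n%:R by rewrite raddfMn /= f1.
have E := trace_mul_reg cT; rewrite trR mulrDr mulr_natr mulrnAr trK in E.
(* As f(1) = 1 and f vanishes on the character of T, it reads off the coefficient of 1 in E; what
   remains is the coefficient of the character. *)
have E1 : (m * b = a * 2)%N.
  apply: natr_inj; have := congr1 f E.
  rewrite !raddfD !raddfMn /= !raddfD !raddfMn /= f1 ftr !mul0rn !addr0 add0r.
  by rewrite !natrM !mulr_natr.
have E2 : (a + l * b = b * 2)%N.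
  apply: natr_inj; apply/eqP; rewrite -subr_eq0.
  have /eqP : ((a + l * b)%:R - (b * 2)%:R) *: \tr T = 0.
    move: E; rewrite !mulrnDl -!mulrnA E1 addrCA => /addrI E2.
    by rewrite scalerBl !scaler_nat mulrnDr E2 subrr.
  by rewrite scaler_eq0 (negPf nzT) orbF.
have {}ab : (16 = a + b * 2)%N by rewrite -ab -dimH dimvf.
(* l = 1 gives m = 2, a = b and 3 a = 16; l = 2 gives m = 0 and a = 0. *)
have [l1|l2] : l = 1%N \/ l = 2%N by lia.
  by subst l; lia.
by subst l; lia.
Qed.

End NoM2.

Theorem proposition8p1 (k : closedFieldType) (char0 : [pchar k] =i pred0)
    (H : hopfAlgType k) (dimH : \dim {:H} = 16%N) :
  [/\ ~ coalg_iso (subcoalg_of (coradical H))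
         (subcoalg_of (unit_subcoalg H) * mxcoalg 2 k)%type,
      ~ coalg_iso (subcoalg_of (coradical H))
         (subcoalg_of (unit_subcoalg H)
          * mxcoalg 2 k * mxcoalg 2 k * mxcoalg 2 k)%type,
      ~ coalg_iso (subcoalg_of (coradical H))
         (subcoalg_of (unit_subcoalg H) * mxcoalg 3 k)%type
    & ~ coalg_iso (subcoalg_of (coradical H))
         (subcoalg_of (unit_subcoalg H) * mxcoalg 2 k * mxcoalg 3 k)%type].
Proof.
split.
- exact: no_coradical_M2.
- exact: no_coradical_M2M2M2.
- exact: no_coradical_M3.
- exact: no_coradical_M2M3.
Qed.
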